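(* Let $n\geq1$ and let $S_n$ be a polynomial of degree $n$ with leading coefficient $c$. (i) If $K=\{z\in\mathbb C:(1+z)S_n^2(z)\in[0,1]\}\subset[-1,1]$, then $$T^{(K)}_{2n+1}(z)=\frac{(1+z)S_n^2(z)}{c^2}-2\,\mathrm{Cap}(K)^{2n+1}.$$ (ii) If $K=\{z\in\mathbb C:(1-z)S_n^2(z)\in[0,1]\}\subset[-1,1]$, then $$T^{(K)}_{2n+1}(z)=2\,\mathrm{Cap}(K)^{2n+1}-\frac{(1-z)S_n^2(z)}{c^2}.$$
   Context: $\mathrm{Cap}(K)$ is logarithmic capacity. $T^{(K)}_m$ denotes the (unweighted) Chebyshev polynomial of $K$: the monic polynomial of degree $m$ minimizing the sup-norm $\|P_m\|_K$ over all monic polynomials $P_m$ of degree $m$. *)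

(* Defs.v *)
From HB Require Import structures.
From mathcomp Require Import all_boot all_order all_algebra.
From mathcomp Require Import all_classical all_reals all_analysis.
From mathcomp Require Import complex.
Set Implicit Arguments. Unset Strict Implicit. Unset Printing Implicit Defensive.
Import Order.TTheory GRing.Theory Num.Theory.
Local Open Scope ring_scope.
Local Open Scope classical_set_scope.
Local Open Scope complex_scope.

Section Defs.
Variable R : realType.

Definition cabs (z : R[i]) : R := Num.sqrt (complex.Re z ^+ 2 + complex.Im z ^+ 2).

Definition in_real_segment (a b : R) (z : R[i]) : Prop :=
  complex.Im z = 0 /\ a <= complex.Re z <= b.

Definition preim01 (p : {poly R[i]}) : set R[i] :=
  [set z | in_real_segment 0 1 p.[z]].

Definition supnorm (K : set R[i]) (P : {poly R[i]}) : \bar R :=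
  ereal_sup [set (cabs P.[z])%:E | z in K].

Definition is_chebyshev (K : set R[i]) (m : nat) (T : {poly R[i]}) : Prop :=
  [/\ T \is monic, size T = m.+1 &
      forall Q : {poly R[i]}, Q \is monic -> size Q = m.+1 ->
        (supnorm K T <= supnorm K Q)%E].

(* Logarithmic capacity, via the energy of probability measures.
   Only used for compact K contained in the real line, so the Borel
   probability measures carried by K are measures on R. *)
Definition real_trace (K : set R[i]) : set R := [set x : R | K x%:C].

Definition logkernel (x y : R) : \bar R :=
  if x == y then +oo%E else (- ln `|x - y|)%:E.

Definition log_energy (mu : probability R R) : \bar R :=
  (\int[mu]_x \int[mu]_y logkernel x y)%E.

Definition robin_constant (K : set R[i]) : \bar R :=
  ereal_inf [set log_energy mu | mu in
    [set mu : probability R R | mu (~` real_trace K) = 0%E]].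

Definition Cap (K : set R[i]) : R :=
  match robin_constant K with
  | EFin V => expR (- V)
  | _ => 0
  end.

End Defs.

(* Main.v *)
Require Import Defs.
From HB Require Import structures.
From mathcomp Require Import all_boot all_order all_algebra all_fingroup.
From mathcomp Require Import all_classical all_reals all_analysis.
From mathcomp Require Import measurable_realfun.
From mathcomp Require Import complex ring lra zify.
Set Implicit Arguments. Unset Strict Implicit. Unset Printing Implicit Defensive.
Import Order.TTheory GRing.Theory Num.Theory.
Import numFieldNormedType.Exports.
Local Open Scope classical_set_scope.
Local Open Scope ring_scope.

(** Let P be a polynomial of degree m with leading coefficient a and with
    K = P^{-1}([0, 1]) contained in [-1, 1]. All the roots y_j(s) of P - s, for
    s in [0, 1], are real, so P and P - 1, hence a, are real.

    Extremality: for monic Q of degree m, Newton's identities make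
    sum_j Q(y_j(1)) - sum_j Q(y_j(0)) = m / a. So |Q| >= 1/(2|a|) somewhere on K,
    and if |Q| <= 1/(2|a|) on K then Q agrees with W = (P - 1/2)/a at all roots
    of P and of P - 1; then P (P - 1) divides (Q - W) P', whence Q = W.

    Capacity: Cap(K)^m = 1/(4|a|). The distribution of a random root of P - s,
    with s following the arcsine law, has potential ln(4|a|)/m on K, since
    sum_j ln|x - y_j(s)| = ln|P(x) - s| - ln|a| and the arcsine potential is ln 4
    on [0, 1]. Conversely, for any measure on K some N points of K have pairwise
    logarithmic energy at most its average, while a Vandermonde determinant in
    the basis X^r D_k(W), with D_k the Dickson polynomials, bounds that energy
    from below.

    Finally the sign of a is read off from P(-1) = 0 or P(1) = 0. *)

(** * Extremality and uniqueness *)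

Section Roots.
Variable F : fieldType.
Implicit Types (r : seq F) (D Q : {poly F}).

(** Repeated roots are allowed: the derivative loses at most one copy of each linear factor, and [D]
    supplies it. *)
Lemma prod_XsubC_dvdp_mul_deriv r D : {in r, forall y, root D y} ->
  \prod_(y <- r) ('X - y%:P) %| D * (\prod_(y <- r) ('X - y%:P))^`().
Proof.
elim: r => [|y r IH] rD; first by rewrite big_nil dvd1p.
rewrite big_cons derivM derivXsubC mul1r mulrDr dvdp_add//.
  by rewrite dvdp_mul// dvdp_XsubCl rD// mem_head.
rewrite mulrCA dvdp_mul// IH// => z zr.
by rewrite rD// inE zr orbT.
Qed.

(* [A] and [B] are the polynomial part and the numerator of
   [Q P' / P = \sum_y Q(X) / (X - y)]. *)
Lemma mul_deriv_prod_XsubC m r Q : Q \is monic -> size Q = m.+2 ->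
  exists A B : {poly F},
    [/\ Q * (\prod_(y <- r) ('X - y%:P))^`() =
        A * \prod_(y <- r) ('X - y%:P) + B,
        (size A <= m.+1)%N, A`_m = (size r)%:R,
        (size B <= size r)%N & B`_(size r).-1 = \sum_(y <- r) Q.[y]].
Proof.
move=> Qmon sQ; elim: r => [|y r [A [B [E sA Am sB Br]]]].
  exists 0, 0; rewrite !big_nil !coef0 !size_poly0 derivC; split => //.
  by rewrite mul0r mulr0 addr0.
pose P := \prod_(y <- r) ('X - y%:P).
have sP : size P = (size r).+1 by rewrite /P size_prod_XsubC.
have Pmon : P \is monic by exact: monic_prod_XsubC.
have [A1 EA1] : exists A1, Q - Q.[y]%:P = A1 * ('X - y%:P).
  by apply/factor_theorem; rewrite rootE !hornerE subrr.
have sQy : size (Q - Q.[y]%:P) = m.+2.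
  by rewrite size_polyDl ?size_polyN sQ// (leq_ltn_trans (size_polyC_leq1 _)).
have A1N0 : A1 != 0.
  by apply: contra_eq_neq EA1 => ->; rewrite mul0r -size_poly_eq0 sQy.
have sA1 : size A1 = m.+1.
  by move: sQy; rewrite EA1 size_Mmonic ?monicXsubC// size_XsubC addn2 /= => -[].
have A1m : A1`_m = 1.
  have : lead_coef (Q - Q.[y]%:P) = 1.
    rewrite lead_coefE sQy /= coefB coefC /= subr0.
    by move/monicP: Qmon; rewrite lead_coefE sQ.
  by rewrite EA1 lead_coefM lead_coefXsubC mulr1 lead_coefE sA1.
exists (A1 + A), (Q.[y] *: P + ('X - y%:P) * B); split.
- rewrite big_cons derivM derivXsubC mul1r -/P mulrDr -mul_polyC.
  rewrite [Q * (_ * _)]mulrCA E -/P.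
  have -> : Q * P = (A1 * ('X - y%:P) + Q.[y]%:P) * P by rewrite -EA1 subrK.
  ring.
- by rewrite (leq_trans (size_polyD _ _))// geq_max sA sA1 leqnn.
- by rewrite coefD A1m Am /= -natr1 addrC.
- rewrite (leq_trans (size_polyD _ _))// geq_max (leq_trans (size_scale_leq _ _)) ?sP//=.
  by rewrite (leq_trans (size_polyMleq _ _))// size_XsubC.
- rewrite big_cons coefD coefZ /=.
  have -> : P`_(size r) = 1 by move/monicP: Pmon; rewrite lead_coefE sP.
  rewrite mulr1 mulrBl coefB coefXM mul_polyC coefZ [B`_(size r)]nth_default// mulr0 subr0.
  rewrite -Br; case: eqP => // r0.
  by rewrite r0 in sB *; rewrite nth_default.
Qed.

(** The two products differ by a constant, so they share their derivative [P'] and the two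
    decompositions of [Q P'] can be compared. *)
Lemma sum_roots_sub m (r0 r1 : seq F) (d : F) Q :
  size r0 = m.+1 -> size r1 = m.+1 ->
  \prod_(y <- r0) ('X - y%:P) - \prod_(y <- r1) ('X - y%:P) = d%:P ->
  Q \is monic -> size Q = m.+2 ->
  \sum_(y <- r1) Q.[y] - \sum_(y <- r0) Q.[y] = d *+ m.+1.
Proof.
move=> s0 s1 E Qmon sQ.
have [A0 [B0 [E0 sA0 A0m sB0 <-]]] := mul_deriv_prod_XsubC r0 Qmon sQ.
have [A1 [B1 [E1 sA1 A1m sB1 <-]]] := mul_deriv_prod_XsubC r1 Qmon sQ.
rewrite s0 s1 /= in sB0 sB1 A0m A1m *.
set P0 := \prod_(y <- r0) _ in E E0.
set P1 := \prod_(y <- r1) _ in E E1.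
have P1mon : P1 \is monic by exact: monic_prod_XsubC.
have P0E : P0 = P1 + d%:P by rewrite -E addrC subrK.
have dE : (A0 - A1) * P1 = B1 - B0 - d *: A0.
  rewrite -mul_polyC.
  have : A0 * P0 + B0 = A1 * P1 + B1 by rewrite -E0 -E1 P0E derivD derivC addr0.
  rewrite P0E => /eqP; rewrite -subr_eq0 => /eqP H.
  by apply/eqP; rewrite -subr_eq0 -H; apply/eqP; ring.
(* The right side of [dE] has degree at most [m] and [P1] has degree [m.+1], so both sides vanish.
   The coefficient of degree [m] then gives the claim. *)
have A01 : A0 - A1 = 0.
  apply/eqP; apply: contraTT isT => A01.
  have := size_Mmonic A01 P1mon.
  rewrite size_prod_XsubC s1 dE addnS /= => sE.
  have : (size (B1 - B0 - d *: A0)%R <= m.+1)%N.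
    rewrite (leq_trans (size_polyD _ _))// geq_max size_polyN.
    rewrite (leq_trans (size_scale_leq _ _))// andbT.
    by rewrite (leq_trans (size_polyD _ _))// geq_max size_polyN sB0 sB1.
  by rewrite sE addnS ltnS -[X in (_ <= X)%N]add0n leq_add2r leqn0 size_poly_eq0 (negbTE A01).
move/eqP: dE; rewrite A01 mul0r eq_sym subr_eq0 => /eqP/polyP/(_ m).
by rewrite coefB coefZ A0m mulr_natr.
Qed.

End Roots.

(** * Equality case of the extremal bound *)

Section Alternation.
Variable R : realType.
Local Open Scope complex_scope.
Local Notation toC := (map_poly (real_complex R)).

Lemma Re_le_cabs (z : R[i]) : `|complex.Re z| <= cabs z.
Proof.
by rewrite /cabs -sqrtr_sqr ler_wsqrtr// lerDl sqr_ge0.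
Qed.

Lemma cabs_le_Re_eq (z : R[i]) (x : R) :
  cabs z <= `|x| -> complex.Re z = x -> z = x%:C.
Proof.
move=> + xE; case: z xE => u v /= ->; rewrite /cabs /=.
rewrite -sqrtr_sqr ler_sqrt ?sqr_ge0// gerDl => v0.
have /eqP : v ^+ 2 = 0 by apply/eqP; rewrite eq_le v0 sqr_ge0.
by rewrite sqrf_eq0 => /eqP ->.
Qed.

Lemma Re_sum (I : Type) (r : seq I) (f : I -> R[i]) :
  complex.Re (\sum_(i <- r) f i) = \sum_(i <- r) complex.Re (f i).
Proof. exact: (raddf_sum (@complex.Re R : {additive R[i] -> R})). Qed.

Lemma sumr_seq_le (I : eqType) (r : seq I) (f : I -> R) (b : R) :
  {in r, forall i, f i <= b} -> \sum_(i <- r) f i <= b *+ size r.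
Proof.
move=> fb; rewrite -iter_addr_0 -(big_const_seq 0 +%R r xpredT) ?count_predT//.
by rewrite [X in X <= _]big_seq [X in _ <= X]big_seq; exact: ler_sum.
Qed.

Lemma sumr_const_eq (I : eqType) (r : seq I) (f : I -> R) (b : R) :
  {in r, forall i, f i <= b} -> b *+ size r <= \sum_(i <- r) f i ->
  {in r, forall i, f i = b}.
Proof.
elim: r => //= i r IH fb; rewrite big_cons mulrS => le_s.
have fi : f i <= b by rewrite fb// mem_head.
have fr : {in r, forall j, f j <= b} by move=> j jr; rewrite fb// inE jr orbT.
have sr := sumr_seq_le fr.
have fiE : f i = b by apply/eqP; rewrite eq_le fi/=; lra.
by move=> j; rewrite inE => /orP[/eqP -> //|]; apply: IH => //; lra.
Qed.

(* By [sum_roots_sub] the values of [Q] on the two sets of roots are extremal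
   on average, hence everywhere extremal. *)
Lemma alternation_unique m (r0 r1 : seq R) (d : R) (Q : {poly R[i]}) :
  size r0 = m.+1 -> size r1 = m.+1 -> d != 0 ->
  \prod_(y <- r0) ('X - y%:P) - \prod_(y <- r1) ('X - y%:P) = d%:P ->
  Q \is monic -> size Q = m.+2 ->
  {in r0 ++ r1, forall y, cabs Q.[y%:C] <= `|d / 2|} ->
  Q = toC (\prod_(y <- r0) ('X - y%:P) - (d / 2)%:P).
Proof.
move=> s0 s1 dN0 E Qmon sQ Qle.
pose P0 := \prod_(y <- r0) ('X - y%:P); pose P1 := \prod_(y <- r1) ('X - y%:P).
have toC_prod r : toC (\prod_(y <- r) ('X - y%:P)) =
    \prod_(y <- [seq x%:C | x <- r]) ('X - y%:P).
  by rewrite rmorph_prod big_map; apply: eq_bigr => y _; rewrite rmorphB/= map_polyX map_polyC.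
have := @sum_roots_sub _ m [seq x%:C | x <- r0] [seq x%:C | x <- r1] d%:C Q.
rewrite !size_map -!toC_prod -rmorphB /= E map_polyC /= => /(_ s0 s1 erefl Qmon sQ).
rewrite !big_map => /(congr1 (@complex.Re R)).
rewrite raddfB /= raddfMn /= !Re_sum => sumE.
(* The factor [Num.sg d] normalizes the signs: the aim is [f = |d / 2|] on [r1] and [f = - |d / 2|]
   on [r0]. *)
pose f y := Num.sg d * complex.Re Q.[y%:C].
have fle y : y \in r0 ++ r1 -> `|f y| <= `|d / 2|.
  move=> yr; rewrite normrM normr_sg dN0 mul1r.
  exact: le_trans (Re_le_cabs _) (Qle _ yr).
(* A value whose real part exhausts the bound on its modulus has no imaginary part; [e] is the sign
   attached to the root list. *)
have Qval y : y \in r0 ++ r1 -> forall e : R, `|e| = 1 -> e * f y = `|d / 2| ->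
    Q.[y%:C] = (e * (d / 2))%:C.
  move=> yr e e1 fE; apply: cabs_le_Re_eq; first by rewrite normrM e1 mul1r Qle.
  have e2 : e * e = 1 by rewrite -expr2 -real_normK ?num_real// e1 expr1n.
  have sd : Num.sg d * Num.sg d = 1 by rewrite -expr2 sqr_sg dN0.
  transitivity (e * e * (Num.sg d * Num.sg d) * complex.Re Q.[y%:C]).
    by rewrite e2 sd !mul1r.
  rewrite (_ : _ * _ = e * Num.sg d * (e * f y)); last by rewrite /f; ring.
  rewrite fE normrM [`|d|]normrEsg [`|2^-1|]ger0_norm ?invr_ge0//.
  rewrite (_ : _ * _ = e * (Num.sg d * Num.sg d) * (d / 2)); last by ring.
  by rewrite sd mulr1.
have sumf : \sum_(y <- r1) f y + \sum_(y <- r0) - f y = `|d| *+ m.+1.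
  by rewrite sumrN -!mulr_sumr -mulrBr sumE normrEsg mulrnAr.
have d2 : `|d| = `|d / 2| + `|d / 2|.
  by rewrite normrM [`|2^-1|]ger0_norm ?invr_ge0//; lra.
have f1 : {in r1, forall y, f y <= `|d / 2|}.
  by move=> y yr; rewrite (le_trans (ler_norm _))// fle// mem_cat yr orbT.
have f0 : {in r0, forall y, - f y <= `|d / 2|}.
  by move=> y yr; rewrite (le_trans (ler_norm _))// normrN fle// mem_cat yr.
have ler_s r g : size r = m.+1 -> {in r, forall y : R, g y <= `|d / 2|} ->
    \sum_(y <- r) g y <= `|d / 2| *+ m.+1.
  by move=> sr gr; rewrite -sr; exact: sumr_seq_le.
have l1 := ler_s _ _ s1 f1; have l0 := ler_s _ _ s0 f0.
rewrite d2 mulrnDl in sumf.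
have g1 : {in r1, forall y, f y = `|d / 2|}.
  by apply: sumr_const_eq => //; rewrite s1; lra.
have g0 : {in r0, forall y, - f y = `|d / 2|}.
  by apply: sumr_const_eq => //; rewrite s0; lra.
pose D := Q - toC (P0 - (d / 2)%:P).
have evalC (p : {poly R}) y : (toC p).[y%:C] = (p.[y])%:C by rewrite horner_map.
have P1E : P1 = P0 - d%:P by rewrite -E opprB addrC subrK.
have evalP (r : seq R) y : y \in r -> (\prod_(z <- r) ('X - z%:P)).[y] = 0.
  by move=> yr; apply/rootP; rewrite root_prod_XsubC.
have D0 : {in [seq x%:C | x <- r0], forall y, root D y}.
  move=> _ /mapP[y yr ->]; rewrite rootE /D hornerD hornerN evalC.
  rewrite (Qval y _ (-1)) ?mem_cat ?yr ?normrN1// ?mulN1r ?g0//.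
  by rewrite hornerD hornerN hornerC (evalP _ _ yr) sub0r subrr.
have D1 : {in [seq x%:C | x <- r1], forall y, root D y}.
  move=> _ /mapP[y yr ->]; rewrite rootE /D hornerD hornerN evalC.
  rewrite (Qval y _ 1) ?mem_cat ?yr ?orbT ?normr1// ?mul1r ?g1//.
  have := evalP _ _ yr; rewrite -/P1 P1E !hornerD !hornerN !hornerC => P0d.
  by rewrite subr_eq0; apply/eqP; congr (_ %:C); lra.
have dv0 := prod_XsubC_dvdp_mul_deriv D0.
have dv1 := prod_XsubC_dvdp_mul_deriv D1.
rewrite -!toC_prod -/P0 -/P1 in dv0 dv1.
have dP : (toC P1)^`() = (toC P0)^`().
  by rewrite P1E rmorphB /= map_polyC derivB derivC subr0.
rewrite dP in dv1.
(* [P0 - P1] is the nonzero constant [d], so the divisibilities by [P0] and by [P1] combine into one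
   by their product. *)
have cop : coprimep (toC P0) (toC P1).
  apply/Bezout_coprimepP; exists (1, -1); rewrite mul1r mulN1r /=.
  rewrite -rmorphB /= E map_polyC /=.
  by rewrite polyC_eqp1 eq_complex /= negb_and dN0.
have := Gauss_dvdp (D * (toC P0)^`()) cop.
rewrite dv0 dv1 /= => dv.
have sP0 : size P0 = m.+2 by rewrite size_prod_XsubC s0.
have sP1 : size P1 = m.+2 by rewrite size_prod_XsubC s1.
have sPd : size (P0 - (d / 2)%:P) = m.+2.
  by rewrite size_polyDl ?size_polyN sP0// (leq_ltn_trans (size_polyC_leq1 _)).
have Pdmon : toC (P0 - (d / 2)%:P) \is monic.
  rewrite map_monic monicE lead_coefDl ?size_polyN ?sP0 ?(leq_ltn_trans (size_polyC_leq1 _))//.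
  by apply/eqP/monicP/monic_prod_XsubC.
have sD : (size D <= m.+1)%N.
  apply/leq_sizeP => j; rewrite leq_eqVlt => /orP[/eqP <-|mj]; rewrite /D coefB.
    move/monicP: Qmon; move/monicP: Pdmon; rewrite !lead_coefE sQ size_map_poly sPd /= => -> ->.
    by rewrite subrr.
  by rewrite !nth_default ?subrr// ?size_map_poly ?sPd ?sQ.
have sP' : size (toC P0)^`() = m.+1.
  rewrite deriv_map size_map_poly; apply/eqP; rewrite eqn_leq.
  have P0N0 : P0 != 0 by rewrite -size_poly_eq0 sP0.
  have := lt_size_deriv P0N0; rewrite sP0 ltnS => -> /=.
  rewrite ltnNge; apply/negP => /(nth_default 0)/eqP; rewrite coef_deriv.
  have : P0 \is monic by exact: monic_prod_XsubC.
  by move/monicP; rewrite lead_coefE sP0 /= => ->; rewrite pnatr_eq0.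
have sDP : (size (D * (toC P0)^`())%R <= (m.+1 + m.+1).-1)%N.
  rewrite (leq_trans (size_polyMleq _ _))// sP'.
  by rewrite -!subn1 leq_sub2r// leq_add2r.
have sPP : size (toC P0 * toC P1) = (m.+2 + m.+2).-1.
  by rewrite size_mul ?map_poly_eq0 -?size_poly_eq0 ?sP0 ?sP1// !size_map_poly sP0 sP1.
(* The divisor [P0 P1] has degree [2 m + 2], the left side at most [2 m]. *)
have : D * (toC P0)^`() = 0.
  apply/eqP; apply: contraTT dv => DN0; apply/negP => /(dvdp_leq DN0).
  rewrite sPP => /leq_trans/(_ sDP); lia.
move/eqP; rewrite mulf_eq0 -[(toC P0)^`() == 0]size_poly_eq0 sP' orbF subr_eq0.
by move/eqP.
Qed.

End Alternation.

(** * The potential of the arcsine law *)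

Section LogSine.
Variable R : realType.
Local Notation leb := (@lebesgue_measure R).
Implicit Types (f g F : R -> R) (u v t x : R).

Lemma integral_is_derive f F (a b : R) : a < b -> continuous f ->
  {in `[a, b], forall x, is_derive x 1 F (f x)} ->
  (\int[leb]_(x in `[a, b]) (f x)%:E = (F b - F a)%:E)%E.
Proof.
move=> ab cf dF; rewrite EFinB.
have cF x : x \in `[a, b] -> {for x, continuous F}.
  move=> xab; apply/differentiable_continuous/derivable1_diffP.
  by case: (dF x xab).
apply: continuous_FTC2 => //.
- exact: continuous_subspaceT.
- split.
  + by move=> x xab; case: (dF x _) => //; exact: subset_itv_oo_cc.
  + by apply: cvg_at_right_filter; apply: cF; rewrite in_itv/= lexx ltW.
  + by apply: cvg_at_left_filter; apply: cF; rewrite in_itv/= lexx ltW.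
- move=> x xab; rewrite derive1E.
  by have [] := dF x (subset_itv_oo_cc xab).
Qed.

Lemma continuous_antiderivative f (a b : R) : a < b -> continuous f ->
  exists F, {in `]a, b[, forall x, is_derive x 1 F (f x)}.
Proof.
move=> ab cf.
exists (fun x => \int[leb]_(t in `[a, x]) f t)%R => x.
rewrite in_itv/= => /andP[ax xb].
have fi : leb.-integrable `[a, b] (EFin \o f).
  apply: continuous_compact_integrable; first exact: segment_compact.
  exact: continuous_subspaceT.
have [D E] := continuous_FTC1_closed xb fi ax (cf x).
by apply: DeriveDef; [exact: D|rewrite -derive1E; exact: E].
Qed.

Section Periodic.
Variable g : R -> R.
Hypothesis cg : continuous g.
Hypothesis g1 : forall x, g (x + 1) = g x.

Let is_derive_affine (F : R -> R) (c d x : R) : is_derive (c * x + d) 1 F (g (c * x + d)) ->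
  is_derive x 1 (fun x => F (c * x + d)) (c * g (c * x + d)).
Proof.
move=> dF.
have dl : is_derive x 1 (fun x : R => c * x + d) c.
  by apply: is_derive_eq; rewrite addr0 /GRing.scale/= mulr1.
by rewrite mulrC; exact: (@is_derive1_comp _ F (fun x => c * x + d) x _ _ dF dl).
Qed.

Let cont_affine (c d : R) : continuous (fun x => g (c * x + d)).
Proof.
move=> x; apply: (@continuous_comp _ _ _ (fun x => c * x + d) g); last exact: cg.
by apply: cvgD; [apply: cvgM; [exact: cvg_cst|exact: cvg_id]|exact: cvg_cst].
Qed.

(** [t / 2] and [t / 2 + 1 / 2] together sweep one period, and so do [u / 2 + t / 2] and
    [u / 2 - t / 2]; the half speed accounts for the factor 2. An antiderivative [F] stands in for a
    change of variables. *)
Lemma integral_periodic : exists I : R,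
  [/\ (\int[leb]_(t in `[0%R, 1%R]) (g t)%:E = I%:E)%E,
      (\int[leb]_(t in `[0%R, 1%R]) (g (2^-1 * t + 0) + g (2^-1 * t + 2^-1))%:E
        = (2 * I)%:E)%E &
      forall u, 0 <= u <= 1 ->
      (\int[leb]_(t in `[0%R, 1%R]) (g (2^-1 * t + u / 2) + g (- 2^-1 * t + u / 2))%:E
        = (2 * I)%:E)%E].
Proof.
have ab : (- 2 : R) < 3 by lra.
have [F dF] := continuous_antiderivative ab cg.
have dFx x : - 2 < x -> x < 3 -> is_derive x 1 F (g x).
  by move=> x2 x3; apply: dF; rewrite in_itv/= x2 x3.
have dFa (c d x : R) : - 2 < c * x + d -> c * x + d < 3 ->
    is_derive x 1 (fun x => F (c * x + d)) (c * g (c * x + d)).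
  by move=> ? ?; apply: is_derive_affine; exact: dFx.
(* By periodicity [F (x + 1) - F x] has zero derivative. *)
have per a b : - 2 < a -> b < 2 -> a < b -> F (b + 1) - F b = F (a + 1) - F a.
  move=> a2 b2 lab.
  have := @integral_is_derive (cst 0) (fun x => F (1 * x + 1) - F (1 * x + 0)) a b lab.
  rewrite integral0 => H.
  have : (0 = (F (1 * b + 1) - F (1 * b + 0) - (F (1 * a + 1) - F (1 * a + 0)))%:E :> \bar R)%E.
    apply: H; first exact: cst_continuous.
    move=> x; rewrite in_itv/= => /andP[ax xb].
    have d1 : is_derive x 1 (fun x => F (1 * x + 1)) (1 * g (1 * x + 1)) by apply: dFa; lra.
    have d2 : is_derive x 1 (fun x => F (1 * x + 0)) (1 * g (1 * x + 0)) by apply: dFa; lra.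
    by apply: is_derive_eq; rewrite !mul1r g1 addr0 subrr.
  by rewrite !mul1r !addr0 => -[]; lra.
exists (F 1 - F 0); split.
- apply: integral_is_derive => // x; rewrite in_itv/= => /andP[x0 x1].
  by apply: dFx; lra.
- have H := @integral_is_derive (fun t => g (2^-1 * t + 0) + g (2^-1 * t + 2^-1))
    (fun t => 2 * F (2^-1 * t + 0) + 2 * F (2^-1 * t + 2^-1)) 0 1 ltr01.
  rewrite H.
  + congr EFin; rewrite !mulr0 !add0r mulr1 !addr0.
    by rewrite (_ : 2^-1 + 2^-1 = 1 :> R); [ring|field].
  + by move=> x; apply: continuousD; exact: cont_affine.
  + move=> x; rewrite in_itv/= => /andP[x0 x1].
    have d1 : is_derive x 1 (fun x => F (2^-1 * x + 0))
        (2^-1 * g (2^-1 * x + 0))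
      by apply: dFa; lra.
    have d2 : is_derive x 1 (fun x => F (2^-1 * x + 2^-1))
        (2^-1 * g (2^-1 * x + 2^-1))
      by apply: dFa; lra.
    by apply: is_derive_eq; rewrite /GRing.scale/=; field.
- move=> u /andP[u0 u1].
  have H := @integral_is_derive (fun t => g (2^-1 * t + u / 2) + g (- 2^-1 * t + u / 2))
    (fun t => 2 * F (2^-1 * t + u / 2) - 2 * F (- 2^-1 * t + u / 2)) 0 1 ltr01.
  rewrite H.
  + congr EFin; rewrite !mulr0 !add0r !mulr1.
    have -> : 2^-1 + u / 2 = (- 2^-1 + u / 2) + 1 by field.
    (* [per] compares two distinct points; at [u = 1] they coincide. *)
    have [->|uN1] := eqVneq u 1.
      have -> : - 2^-1 + 1 / 2 = 0 :> R by field.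
      by rewrite add0r; ring.
    have : F (0 + 1) - F 0 = F (- 2^-1 + u / 2 + 1) - F (- 2^-1 + u / 2).
      by apply: per => //; try lra; move: uN1; rewrite neq_lt; lra.
    by rewrite add0r; lra.
  + by move=> x; apply: continuousD; exact: cont_affine.
  + move=> x; rewrite in_itv/= => /andP[x0 x1].
    have d1 : is_derive x 1 (fun x => F (2^-1 * x + u / 2))
        (2^-1 * g (2^-1 * x + u / 2))
      by apply: dFa; lra.
    have d2 : is_derive x 1 (fun x => F (- 2^-1 * x + u / 2))
        (- 2^-1 * g (- 2^-1 * x + u / 2))
      by apply: dFa; lra.
    by apply: is_derive_eq; rewrite /GRing.scale/=; field.
Qed.

End Periodic.

(** Cutting the sine off at [d > 0] keeps the function finite and continuous; the cutoff is removed
    later by letting [d] tend to 0. *)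
Definition neglogsin (d v : R) : R := - ln (Num.max `|sin (pi * v)| d).

Lemma sin_abs_le1 x : `|sin x| <= 1 :> R.
Proof. by rewrite ler_norml sin_geN1 sin_le1. Qed.

Section Truncated.
Variable d : R.
Hypotheses (d0 : 0 < d) (d1 : d <= 1).

Let maxd_gt0 (x : R) : 0 < Num.max x d.
Proof. by rewrite lt_max d0 orbT. Qed.

Lemma neglogsin_continuous : continuous (neglogsin d).
Proof.
move=> x; apply: cvgN.
apply: (@continuous_comp _ _ _ (fun v => Num.max `|sin (pi * v)| d) (@ln R)); last first.
  exact: continuous_ln.
apply: (@continuous_max _ _ (fun v => `|sin (pi * v)|) (cst d)); last exact: cst_continuous.
apply: (@continuous_comp _ _ _ (fun v => sin (pi * v)) (@Num.norm _ R)); last exact: norm_continuous.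
apply: (@continuous_comp _ _ _ (fun v : R => pi * v) (@sin R)); last exact: continuous_sin.
by apply: cvgM; [exact: cvg_cst|exact: cvg_id].
Qed.

Lemma neglogsin_periodic x : neglogsin d (x + 1) = neglogsin d x.
Proof. by rewrite /neglogsin mulrDr mulr1 sinDpi normrN. Qed.

Lemma neglogsin_ge0 x : 0 <= neglogsin d x.
Proof. by rewrite oppr_ge0 ln_le0// ge_max sin_abs_le1. Qed.

(** This is [sin 2a = 2 sin a cos a] in logarithmic form; the cutoff weakens the equality to an
    inequality. *)
Lemma neglogsin_double v :
  neglogsin d (2^-1 * v + 0) + neglogsin d (2^-1 * v + 2^-1) <= neglogsin d v + ln 2.
Proof.
rewrite /neglogsin addr0 mulrDr -[pi * 2^-1]/(pi / 2) sinDpihalf.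
set a := pi * (2^-1 * v).
have -> : pi * v = a *+ 2 by rewrite /a -mulr_natr; field.
rewrite sin_mulr2n -mulr_natr normrM normrM [`|2|]ger0_norm//.
have csE : `|cos a| ^+ 2 + `|sin a| ^+ 2 = 1.
  by rewrite !real_normK ?num_real// cos2Dsin2.
set A := `|sin a| in csE *; set B := `|cos a| in csE *.
have A0 : 0 <= A by exact: normr_ge0.
  have B0 : 0 <= B by exact: normr_ge0.
suff : Num.max (B * A * 2) d <= Num.max A d * Num.max B d * 2.
  rewrite -ler_ln ?posrE ?mulr_gt0// lnM ?posrE ?mulr_gt0//.
  by rewrite [in X in _ <= X -> _]lnM ?posrE//; lra.
have lA : A <= Num.max A d by rewrite le_max lexx.
have lB : B <= Num.max B d by rewrite le_max lexx.
have lAd : d <= Num.max A d by rewrite le_max lexx orbT.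
have lBd : d <= Num.max B d by rewrite le_max lexx orbT.
rewrite ge_max; apply/andP; split; first nra.
(* As [A ^+ 2 + B ^+ 2 = 1], the larger of [A] and [B] is at least 1/2, which absorbs the factor 2
   and leaves [d]. *)
have [AB|BA] := leP A B.
  have : 2^-1 <= B by nra.
  by move=> hB; nra.
have : 2^-1 <= A by nra.
by move=> hA; nra.
Qed.

(* The doubling inequality gives [2 I <= I + ln 2] for the mean [I]; the
   truncation at [d] makes [I] finite. *)
Lemma integral_neglogsin_le u : 0 <= u <= 1 ->
  (\int[leb]_(t in `[0%R, 1%R])
    (neglogsin d (2^-1 * t + u / 2) + neglogsin d (- 2^-1 * t + u / 2))%:E
  <= (2 * ln 2)%:E)%E.
Proof.
move=> u01.
have [I [I1 I2 /(_ u u01) ->]] := integral_periodic neglogsin_continuous neglogsin_periodic.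
rewrite lee_fin ler_pM2l// -lee_fin.
have mg : measurable_fun [set: R] (neglogsin d).
  exact: (continuous_measurable_fun neglogsin_continuous).
have mga (c e : R) :
    measurable_fun (`[0%R, 1%R]%classic : set R) (fun t => neglogsin d (c * t + e)).
  apply: measurable_funTS; apply: measurableT_comp => //.
  by apply: measurable_funD => //; exact: measurable_funM.
suff : ((2 * I)%:E <= I%:E + (ln 2)%:E :> \bar R)%E by rewrite -EFinD !lee_fin; lra.
rewrite -I2 -I1.
have -> : ((ln 2)%:E = \int[leb]_(t in `[0%R, 1%R]) (ln 2)%:E :> \bar R)%E.
  rewrite integral_cst//= lebesgue_measure_itv/= lte_fin ltr01.
  by rewrite -EFinD subr0 mule1.
rewrite -ge0_integralD//=.
- apply: ge0_le_integral => //=.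
  + by move=> x _; rewrite lee_fin addr_ge0// neglogsin_ge0.
  + by apply/measurable_EFinP; apply: measurable_funD; exact: mga.
  + apply/measurable_EFinP; apply: measurable_funD => //; exact: measurable_funTS.
  + by move=> x _; rewrite -EFinD lee_fin neglogsin_double.
- by move=> x _; rewrite lee_fin neglogsin_ge0.
- by apply/measurable_EFinP; exact: measurable_funTS.
- by move=> x _; rewrite lee_fin ln_ge0// ler1n.
Qed.

End Truncated.

(* Its values at uniformly distributed [t] follow the equilibrium measure of
   [[0, 1]]. *)
Definition cosunit (t : R) : R := (1 + cos (pi * t)) / 2.

Lemma cosunit_continuous : continuous cosunit.
Proof.
move=> x; apply: cvgM; last exact: cvg_cst.
apply: cvgD; first exact: cvg_cst.
apply: (@continuous_comp _ _ _ (fun v : R => pi * v) (@cos R)); last exact: continuous_cos.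
by apply: cvgM; [exact: cvg_cst|exact: cvg_id].
Qed.

Lemma cosunit_itv t : 0 <= cosunit t <= 1.
Proof.
by rewrite /cosunit; have := cos_geN1 (pi * t); have := cos_le1 (pi * t); lra.
Qed.

Lemma cosunit_surj x : 0 <= x <= 1 -> exists2 t, 0 <= t <= 1 & cosunit t = x.
Proof.
move=> /andP[x0 x1]; have x11 : - 1 <= 2 * x - 1 <= 1 by lra.
exists (acos (2 * x - 1) / pi).
  rewrite divr_ge0 ?pi_ge0 ?acos_ge0//=.
  by rewrite ler_pdivrMr ?pi_gt0// mul1r acos_lepi.
rewrite /cosunit mulrCA divff ?gt_eqF ?pi_gt0// mulr1 acosK ?in_itv//.
by field.
Qed.

(** The product formula splits the logarithmic kernel into two log-sine terms whose arguments
    together sweep one period. *)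
Lemma cosunit_dist u t : `|cosunit u - cosunit t| =
  `|sin (pi * (2^-1 * t + u / 2))| * `|sin (pi * (- 2^-1 * t + u / 2))|.
Proof.
rewrite -normrM -normrN; congr `|_|; rewrite /cosunit.
set a := pi * (2^-1 * t + u / 2); set b := pi * (- 2^-1 * t + u / 2).
have -> : pi * u = a + b by rewrite /a /b; field.
have -> : pi * t = a - b by rewrite /a /b; field.
by rewrite cosD cosB; field.
Qed.

(** With cutoffs [exp (- k)] the truncated integrands increase to the kernel, and the uniform bound
    passes to the limit by monotone convergence. The value [2 ln 2 = ln 4] is the Robin constant of
    [[0, 1]]. *)
Lemma integral_logkernel_cosunit u : 0 <= u <= 1 ->
  (\int[leb]_(t in `[0%R, 1%R]) logkernel (cosunit u) (cosunit t) <= (2 * ln 2)%:E)%E.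
Proof.
move=> u01; pose d (k : nat) : R := expR (- k%:R).
have d0 k : 0 < d k by exact: expR_gt0.
have d1 k : d k <= 1 by rewrite /d -expR0 ler_expR oppr_le0.
pose f k t := (neglogsin (d k) (2^-1 * t + u / 2) + neglogsin (d k) (- 2^-1 * t + u / 2))%:E.
have f0 k t : (0 <= f k t)%E by rewrite lee_fin addr_ge0// neglogsin_ge0.
have mf k : measurable_fun (`[0%R, 1%R]%classic : set R) (f k).
  apply/measurable_EFinP; apply: measurable_funTS; apply: measurable_funD.
    apply: measurableT_comp; first exact: continuous_measurable_fun (neglogsin_continuous (d0 k)).
    by apply: measurable_funD => //; exact: measurable_funM.
  apply: measurableT_comp; first exact: continuous_measurable_fun (neglogsin_continuous (d0 k)).
  by apply: measurable_funD => //; exact: measurable_funM.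
have nd t : {homo f ^~ t : m n / (m <= n)%N >-> (m <= n)%E}.
  move=> m n mn; rewrite lee_fin.
  have h v : neglogsin (d m) v <= neglogsin (d n) v.
    rewrite lerN2 ler_ln ?posrE ?lt_max ?d0 ?orbT// ge_max le_max lexx /=.
    by rewrite le_max ler_expR lerN2 ler_nat mn orbT.
  exact: lerD.
have neglog_eq k v : d k <= `|sin (pi * v)| -> neglogsin (d k) v = - ln `|sin (pi * v)|.
  by move=> h; rewrite /neglogsin max_l.
have lim t : f k t @[k --> \oo] --> logkernel (cosunit u) (cosunit t).
  rewrite /logkernel -subr_eq0 -normr_eq0 cosunit_dist.
  set A := `|sin _|; set B := `|sin _|.
  have A0 : 0 <= A by exact: normr_ge0.
  have B0 : 0 <= B by exact: normr_ge0.
  (* If a sine vanishes, its truncated term equals [k]; otherwise the sequence is constant once the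
     cutoff lies below both sines. *)
  have [AB0|ABN0] := eqVneq (A * B) 0.
    apply/cvgeyPge => M; near=> k.
    have Mk : M <= k%:R by near: k; exact: nbhs_infty_ger.
    rewrite /f lee_fin.
    have h0 v : `|sin (pi * v)| = 0 -> neglogsin (d k) v = k%:R.
      by move=> h; rewrite /neglogsin h max_r ?ltW// expRK opprK.
    have [/h0|/h0] : A = 0 \/ B = 0 by move/eqP: AB0; rewrite mulf_eq0 => /orP[] /eqP; [left|right].
      by move=> ->; rewrite (le_trans Mk)// lerDl neglogsin_ge0.
    by move=> ->; rewrite (le_trans Mk)// lerDr neglogsin_ge0.
  have Ap : 0 < A by rewrite lt_def A0 andbT; apply: contra_neq ABN0 => ->; rewrite mul0r.
  have Bp : 0 < B by rewrite lt_def B0 andbT; apply: contra_neq ABN0 => ->; rewrite mulr0.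
  apply: cvg_near_cst; near=> k.
  have kA : d k <= A.
    rewrite -ler_ln ?posrE// expRK lerNl.
    by near: k; exact: nbhs_infty_ger.
  have kB : d k <= B.
    rewrite -ler_ln ?posrE// expRK lerNl.
    by near: k; exact: nbhs_infty_ger.
  by rewrite /f !neglog_eq// lnM ?posrE// opprD.
have <- : (\int[leb]_(t in `[0%R, 1%R]) limn (f ^~ t) =
    \int[leb]_(t in `[0%R, 1%R]) logkernel (cosunit u) (cosunit t))%E.
  by apply: eq_integral => t _; apply: cvg_lim => //; exact: lim.
have cv := @cvg_monotone_convergence _ _ _ leb `[0%R, 1%R]%classic (measurable_itv _) f
  mf (fun k t _ => f0 k t) (fun t _ => nd t).
apply: (cvge_le _ cv).
by apply: nearW => k; exact: integral_neglogsin_le.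
Unshelve. all: by end_near. Qed.

End LogSine.

(** * Energy of a measure and of finite point sets *)

Section ProbabilityIntegral.
Context d (T : measurableType d) (R : realType) (mu : probability T R).
Local Open Scope ereal_scope.

(** The integral of [f] may be infinite. The negative part of the shifted function stays below
    [|c|], so an infinite integral remains infinite. *)
Lemma integral_addr_cst (f : T -> \bar R) (c : R) :
  measurable_fun setT f -> (forall x, 0 <= f x) ->
  \int[mu]_x (f x + c%:E) = \int[mu]_x f x + c%:E.
Proof.
move=> mf f0.
have intc (r : R) : \int[mu]_x r%:E = r%:E.
  by rewrite integral_cst// -[RHS]mule1; congr (_ * _); exact: probability_setT.
have mfc : measurable_fun setT (fun x => f x + c%:E) by exact: emeasurable_funD.
have [fi|] := ltP (\int[mu]_x f x) +oo.
  rewrite integralD//=; first by rewrite intc.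
    apply/integrableP; split => //.
    by under eq_integral do rewrite gee0_abs//.
  exact: finite_measure_integrable_cst.
rewrite leye_eq => /eqP foo; rewrite foo addye//.
have neg_fin : \int[mu]_x (fun x => f x + c%:E)^\- x <= `|c|%:E.
  rewrite -(intc `|c|%R); apply: ge0_le_integral => //.
    by apply: measurable_funeneg.
  move=> x _; rewrite funenegE ge_max lee_fin normr_ge0 andbT.
  case: (f x) (f0 x) => [r| |]//=; last by rewrite leNye.
  rewrite !lee_fin => r0.
  by have := ler_norm (- c)%R; rewrite normrN; lra.
have pos_inf : \int[mu]_x (fun x => f x + c%:E)^\+ x = +oo.
  apply/eqP; rewrite -leye_eq; apply: contraT => /negP; rewrite leye_eq => /negP posN.
  have : \int[mu]_x f x <= \int[mu]_x ((fun x => f x + c%:E)^\+ x + `|c|%:E).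
    apply: ge0_le_integral => //.
      by apply: emeasurable_funD => //; exact: measurable_funepos.
    move=> x _; rewrite funeposE; case: (f x) (f0 x) => [r| |]//= r0.
    rewrite -EFinD -EFin_max -EFinD lee_fin.
    have := ler_norm (- c)%R; rewrite normrN.
    have : (r + c <= Num.max (r + c) 0)%R by rewrite le_max lexx.
    lra.
  rewrite ge0_integralD//=; last exact: measurable_funepos.
  rewrite intc foo leye_eq => /eqP.
  have : 0 <= \int[mu]_x (fun x => f x + c%:E)^\+ x by exact: integral_ge0.
  by move: posN; case: (\int[mu]_x _ x).
rewrite integralE pos_inf.
have : 0 <= \int[mu]_x (fun x => f x + c%:E)^\- x by exact: integral_ge0.
by move: neg_fin; case: (\int[mu]_x (fun x => f x + c%:E)^\- x).
Qed.

Variable A : set T.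
Hypotheses (mA : measurable A) (muA : mu (~` A) = 0).

Lemma eq_integral_full (f g : T -> \bar R) :
  measurable_fun setT f -> measurable_fun setT g ->
  (forall x, A x -> f x = g x) -> \int[mu]_x f x = \int[mu]_x g x.
Proof.
move=> mf mg fg; apply: ae_eq_integral => //.
exists (~` A); split => //; first exact: measurableC.
by move=> x /= fgx Ax; apply: fgx => _; exact: fg.
Qed.

Lemma probability_full : mu A = 1.
Proof.
have : mu (A `|` ~` A) = mu A + mu (~` A).
  by rewrite measureU//; [exact: measurableC|exact: setICr].
by rewrite setUv muA adde0 => <-; exact: probability_setT.
Qed.

(** Otherwise [f] would exceed its integral by more than 1 on a set of full measure. This makes the
    integral finite, and integrating over that set is then absurd. *)
Lemma exists_le_integral (f : T -> \bar R) :
  measurable_fun setT f -> (forall x, 0 <= f x) ->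
  exists2 x, A x & f x <= \int[mu]_x f x + 1.
Proof.
move=> mf f0; apply: contrapT => H.
have {}H x : A x -> \int[mu]_x f x + 1 < f x.
  by move=> Ax; rewrite ltNge; apply/negP => fx; apply: H; exists x.
have [x Ax] : A !=set0.
  apply/set0P/eqP => A0; have := probability_full.
  by rewrite A0 measure0 => /eqP; rewrite eq_sym onee_eq0.
have Ifin : \int[mu]_x f x \is a fin_num.
  rewrite ge0_fin_numE; last exact: integral_ge0.
  have := lt_le_trans (H x Ax) (leey _).
  by apply: le_lt_trans; rewrite leeDl// lee01.
have : \int[mu]_x f x + 1 <= \int[mu]_x f x.
  rewrite [in leRHS](@ge0_negligible_integral _ _ _ mu setT (~` A))//; last exact: measurableC.
  rewrite setDE setCK setTI.
  have <- : \int[mu]_(y in A) cst (\int[mu]_x f x + 1) y = \int[mu]_x f x + 1.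
    by rewrite integral_cst// -[RHS]mule1; congr (_ * _); exact: probability_full.
  apply: ge0_le_integral => //.
  - by move=> y _; rewrite adde_ge0// integral_ge0.
  - exact: measurable_funTS.
  - by move=> y Ay; exact/ltW/H.
by rewrite leNgt lteDl// lte01.
Qed.

Variable G : T -> T -> \bar R.
Hypothesis mG : measurable_fun setT (fun z : T * T => G z.1 z.2).
Hypothesis G0 : forall x y, 0 <= G x y.

Let U x := \int[mu]_y G x y.

Lemma measurable_kernel_section x : measurable_fun setT (G x).
Proof.
exact: (measurableT_comp mG (pair1_measurable x)).
Qed.

Lemma measurable_kernel_potential : measurable_fun setT U.
Proof. exact: (measurable_fun_fubini_tonelli_F (fun z => G z.1 z.2)). Qed.

(* Successive choices (the method of conditional expectations) replace the
   average of the pair sum over [n] independent points. The [+ 1] at each step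
   is harmless slack that avoids the equality case. *)
Lemma exists_pairwise_sum_le n (h : T -> \bar R) :
  measurable_fun setT h -> (forall x, 0 <= h x) ->
  exists2 x : 'I_n -> T, (forall i, A (x i)) &
    \sum_(i < n) h (x i) + \sum_(i < n) \sum_(j < n | (i < j)%N) G (x i) (x j)
    <= n%:R%:E * (\int[mu]_x h x) + 'C(n, 2)%:R%:E * (\int[mu]_x U x) + n%:R%:E.
Proof.
have shuffle (a b c e f : \bar R) :
    a + b + 1 + (c + e + f) = c + a + (e + b) + (f + 1).
  rewrite -!addeA [RHS]addeCA; congr (_ + _).
  rewrite addeA [LHS]addeC -!addeA; do 2 congr (_ + _); exact: addeCA.
elim: n h => [|n IH] h mh h0.
  exists (fun i : 'I_0 => match i with Ordinal _ p => False_rect T (notF p) end).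
    by case.
  by rewrite !big_ord0 bin_small// !mul0e !adde0.
have mU := measurable_kernel_potential.
have U0 x : 0 <= U x by exact: integral_ge0.
have nR0 k : 0 <= k%:R%:E :> \bar R by rewrite lee_fin.
have Ih0 : 0 <= \int[mu]_x h x by exact: integral_ge0.
have IU0 : 0 <= \int[mu]_x U x by exact: integral_ge0.
have mnU : measurable_fun setT (fun x => n%:R%:E * U x) by exact: measurable_funeM.
(* The new point is chosen by averaging [h] plus its expected interaction with the [n] points to
   come. Its actual interaction is then absorbed into the one-point term [h + G x0]. *)
have [x0 Ax0] : exists2 x, A x & h x + n%:R%:E * U x <=
    \int[mu]_x (h x + n%:R%:E * U x) + 1.
  apply: exists_le_integral; first exact: emeasurable_funD.
  by move=> x; rewrite adde_ge0// mule_ge0.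
rewrite ge0_integralD//; last by move=> x _; rewrite mule_ge0.
rewrite ge0_integralZl// => le_x0.
have mh' : measurable_fun setT (fun y => h y + G x0 y).
  by apply: emeasurable_funD => //; exact: measurable_kernel_section.
have [|xs Axs le_xs] := IH _ mh'; first by move=> y; rewrite adde_ge0.
rewrite ge0_integralD// in le_xs; last exact: measurable_kernel_section.
exists (fun i => if unlift ord0 i is Some j then xs j else x0).
  by move=> i; case: unliftP.
have -> : \sum_(i < n.+1) h (if unlift ord0 i is Some j then xs j else x0) =
    h x0 + \sum_(i < n) h (xs i).
  rewrite big_ord_recl unlift_none; congr (_ + _).
  by apply: eq_bigr => i _; rewrite liftK.
have -> : \sum_(i < n.+1) \sum_(j < n.+1 | (i < j)%N)
      G (if unlift ord0 i is Some j then xs j else x0)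
        (if unlift ord0 j is Some j then xs j else x0) =
    \sum_(j < n) G x0 (xs j) + \sum_(i < n) \sum_(j < n | (i < j)%N) G (xs i) (xs j).
  rewrite big_ord_recl unlift_none; congr (_ + _).
    rewrite big_mkcond big_ord_recl/= add0e.
    by apply: eq_bigr => j _; rewrite liftK.
  apply: eq_bigr => i _; rewrite liftK big_mkcond big_ord_recl/= add0e.
  by rewrite [RHS]big_mkcond/=; apply: eq_bigr => j _; rewrite liftK.
rewrite big_split/= in le_xs.
set Sh := \sum_(i < n) h (xs i) in le_xs *.
set SG := \sum_(j < n) G x0 (xs j) in le_xs *.
set SS := \sum_(i < n) \sum_(j < n | _) _ in le_xs *.
rewrite -addeA.
apply: (@le_trans _ _ (h x0 + (n%:R%:E * (\int[mu]_x h x + U x0) +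
    'C(n, 2)%:R%:E * (\int[mu]_x U x) + n%:R%:E))).
  by apply: leeD2l; rewrite addeA; exact: le_xs.
rewrite ge0_muleDr//.
set a := n%:R%:E * \int[mu]_x h x; set b := n%:R%:E * U x0.
set c := _ * \int[mu]_x U x; set e := n%:R%:E.
rewrite (_ : h x0 + (a + b + c + e) = (h x0 + b) + (a + c + e)); last first.
  by rewrite !addeA; congr (_ + _ + _); rewrite -!addeA; congr (_ + _); exact: addeC.
apply: (@le_trans _ _ (\int[mu]_x h x + n%:R%:E * \int[mu]_x U x + 1 + (a + c + e))).
  by rewrite leeD2r.
rewrite binS bin1 -addn1 natrD EFinD ge0_muleDl// mul1e natrD EFinD ge0_muleDl// -/a -/c.
by rewrite shuffle.
Qed.

End ProbabilityIntegral.

(** * Logarithmic energy on [[-1, 1]] *)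

Section LogEnergy.
Variable R : realType.
Local Open Scope ereal_scope.

Lemma measurable_logkernel :
  measurable_fun setT (fun z : R * R => logkernel z.1 z.2).
Proof.
rewrite /logkernel; apply: measurable_fun_ifT => //.
  by apply: measurable_fun_eqr.
apply/measurable_EFinP; apply: measurable_funN.
apply: measurableT_comp; first exact: measurable_ln.
by apply: measurableT_comp => //; exact: measurable_funB.
Qed.

(* [logkernel] takes both signs; on [[-1, 1]]^2 the truncation is inactive. *)
Definition poskernel (x y : R) : \bar R := maxe (logkernel x y + (ln 2)%:E) 0.

Lemma measurable_poskernel :
  measurable_fun setT (fun z : R * R => poskernel z.1 z.2).
Proof.
apply: measurable_maxe => //; apply: emeasurable_funD => //.
exact: measurable_logkernel.
Qed.

Lemma poskernel_ge0 x y : 0 <= poskernel x y.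
Proof. by rewrite le_max lexx orbT. Qed.

Lemma poskernelE (x y : R) : (-1 <= x <= 1)%R -> (-1 <= y <= 1)%R ->
  poskernel x y = logkernel x y + (ln 2)%:E.
Proof.
move=> x1 y1; rewrite /poskernel max_l// /logkernel; case: eqP => [_|xy]; first by rewrite addye.
rewrite -EFinD lee_fin addrC subr_ge0 ler_ln ?posrE ?normr_gt0 ?subr_eq0//; last exact/eqP.
by rewrite ler_norml; lra.
Qed.

Definition pos_energy (mu : probability R R) : \bar R :=
  \int[mu]_x \int[mu]_y poskernel x y.

(** Points of [[-1, 1]] are at distance at most 2, so adding [ln 2] makes the kernel nonnegative;
    for a probability measure the shift passes through both integrals. Tonelli's theorem then
    applies to the shifted energy. *)
Lemma log_energyE (mu : probability R R) (A : set R) :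
  measurable A -> mu (~` A) = 0 -> A `<=` [set x | (-1 <= x <= 1)%R] ->
  log_energy mu = pos_energy mu - (ln 2)%:E.
Proof.
move=> mA muA A1; rewrite /log_energy /pos_energy.
have mU := measurable_kernel_potential mu measurable_poskernel poskernel_ge0 :
  measurable_fun setT (fun x => \int[mu]_y poskernel x y).
rewrite -EFinN -integral_addr_cst//; last first.
  by move=> x; apply: integral_ge0 => y _; exact: poskernel_ge0.
have mk (x : R) : measurable_fun setT (logkernel x).
  exact: (measurableT_comp measurable_logkernel (pair1_measurable x)).
apply: (eq_integral_full mA muA).
- have mp : measurable_fun setT (fun x => \int[mu]_y (logkernel x)^\+ y).
    under eq_fun do (under eq_integral do rewrite funeposE).
    apply: (@measurable_kernel_potential _ _ _ mu (fun x y => maxe (logkernel x y) 0)).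
      by apply: measurable_maxe => //; exact: measurable_logkernel.
    by move=> x y; rewrite le_max lexx orbT.
  have mn : measurable_fun setT (fun x => \int[mu]_y (logkernel x)^\- y).
    under eq_fun do (under eq_integral do rewrite funenegE).
    apply: (@measurable_kernel_potential _ _ _ mu (fun x y => maxe (- logkernel x y) 0)).
      apply: measurable_maxe => //; apply: measurableT_comp => //.
      exact: measurable_logkernel.
    by move=> x y; rewrite le_max lexx orbT.
  rewrite (_ : (fun x => _) =
    (fun x => \int[mu]_y (logkernel x)^\+ y - \int[mu]_y (logkernel x)^\- y)).
    exact: emeasurable_funB.
  by apply/funext => x; rewrite integralE.
- exact: emeasurable_funD.
- move=> x Ax; rewrite -integral_addr_cst//; last first.
  + by move=> y; exact: poskernel_ge0.
  + exact: (measurable_kernel_section measurable_poskernel).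
  apply: (eq_integral_full mA muA) => //.
    apply: emeasurable_funD => //; exact: (measurable_kernel_section measurable_poskernel).
  move=> y Ay; rewrite poskernelE; [|exact: A1|exact: A1].
  by rewrite -addeA -EFinD subrr adde0.
Qed.

End LogEnergy.

(** * Lower bound for the energy *)

(** The passage from monomials to the basis [q] is unitriangular. *)
Lemma det_monic_Vandermonde (F : comNzRingType) n (q : nat -> {poly F}) (x : 'I_n -> F) :
  (forall i, q i \is monic) -> (forall i, size (q i) = i.+1) ->
  \det (\matrix_(i < n, j < n) (q i).[x j]) =
  \prod_(i < n) \prod_(j < n | (i < j)%N) (x j - x i).
Proof.
move=> qmon sq.
have -> : \matrix_(i < n, j < n) (q i).[x j] =
    (\matrix_(i < n, k < n) (q i)`_k) *m Vandermonde n (\row_j x j).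
  apply/matrixP => i j; rewrite !mxE horner_coef sq.
  rewrite (big_ord_widen n (fun k => (q i)`_k * x j ^+ k)) ?ltn_ord// big_mkcond /=.
  apply: eq_bigr => k _; rewrite !mxE; case: ifPn => //; rewrite -leqNgt => ik.
  by rewrite nth_default ?mul0r// sq.
rewrite det_mulmx det_Vandermonde det_trig; last first.
  by apply/is_trig_mxP => i j ij; rewrite mxE nth_default// sq.
rewrite big1 ?mul1r => [|i _]; last first.
  by rewrite mxE; have /monicP := qmon i; rewrite lead_coefE sq.
by apply: eq_bigr => i _; apply: eq_bigr => j _; rewrite !mxE.
Qed.

(** Leibniz expansion. The factor [n!] is crude, but its logarithm is negligible against the number
    of pairs of points. *)
Lemma normr_det_le (F : realDomainType) n (M : 'M[F]_n) (B : 'I_n -> F) :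
  (forall i j, `|M i j| <= B i) -> `|\det M| <= n`!%:R * \prod_i B i.
Proof.
move=> MB; rewrite /determinant (le_trans (ler_norm_sum _ _ _))//.
rewrite -card_Sn mulr_natl -sumr_const; apply: ler_sum => s _.
rewrite normrM normrX normrN1 expr1n mul1r normr_prod.
by apply: ler_prod => i _; rewrite normr_ge0 MB.
Qed.

(** This is the exponent of [b] in the Vandermonde bound; the quotients form [M] blocks of [m] equal
    values. *)
Lemma sum_divn_ord m M : (0 < m)%N ->
  (2 * \sum_(j < m * M) (j %/ m) = m * (M * M.-1))%N.
Proof.
move=> m0; elim: M => [|M IH]; first by rewrite muln0 big_ord0 !muln0.
rewrite mulnS addnC big_split_ord /= mulnDr IH.
have -> : (\sum_(i < m) ((m * M + i) %/ m) = m * M)%N.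
  rewrite (eq_bigr (fun _ => M)) => [|i _]; first by rewrite sum_nat_const card_ord.
  by rewrite mulnC divnMDl// divn_small ?addn0.
case: M {IH} => [|M] /=; lia.
Qed.

(** * Dickson polynomials of [W] and the basis built from them *)

Section Dickson.
Variables (R : realType) (W : {poly R}) (b : R) (m : nat).
Hypotheses (Wmon : W \is monic) (sW : size W = m.+1) (m0 : (0 < m)%N) (b0 : 0 < b).

(* Dickson polynomials: [2 b^k cos (k t)] when [W = 2 b cos t]. *)
Fixpoint dickson_pair k : {poly R} * {poly R} :=
  if k is k'.+1 then
    let: (u, v) := dickson_pair k' in (v, W * v - (b ^+ 2) *: u)
  else (2%:P, W).

Definition dickson k := (dickson_pair k).1.

Lemma dickson_pairE k : dickson_pair k = (dickson k, dickson k.+1).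
Proof. by rewrite /dickson /=; case: (dickson_pair k). Qed.

Lemma dicksonSS k : dickson k.+2 = W * dickson k.+1 - (b ^+ 2) *: dickson k.
Proof. by rewrite {1}/dickson /= dickson_pairE. Qed.

Lemma dickson_monic_size k :
  (dickson k.+1 \is monic) && (size (dickson k.+1) == (m * k.+1).+1).
Proof.
(* The induction also carries the size of the preceding polynomial, which the recurrence subtracts.
   The monic claim starts at index 1 because [dickson 0] is the constant 2. *)
suff : (dickson k.+1 \is monic) && (size (dickson k.+1) == (m * k.+1).+1) &&
  (size (dickson k) <= (m * k).+1)%N by case/andP.
elim: k => [|k /andP[/andP[monk /eqP sk] sk1]].
  rewrite /dickson /= Wmon sW muln1 eqxx /= muln0.
  exact: size_polyC_leq1.
rewrite sk leqnn andbT dicksonSS.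
have sWd : size (W * dickson k.+1) = (m * k.+2).+1.
  by rewrite size_monicM ?monic_neq0// sW sk; lia.
have lt_s : (size (- (b ^+ 2 *: dickson k))%R < size (W * dickson k.+1)%R)%N.
  rewrite size_polyN (leq_ltn_trans (size_scale_leq _ _))// sWd.
  by rewrite (leq_ltn_trans sk1)//; nia.
by rewrite size_polyDl// sWd eqxx andbT monicE lead_coefDl// -monicE monicMr.
Qed.

Lemma dickson_bound k x : `|W.[x]| <= 2 * b -> `|(dickson k).[x]| <= 2 * b ^+ k.
Proof.
move=> Wx; pose t := acos (W.[x] / (2 * b)).
have b20 : 0 < 2 * b by rewrite mulr_gt0.
have WE : W.[x] = 2 * b * cos t.
  rewrite /t acosK; first by rewrite mulrC divfK// gt_eqF.
  by rewrite in_itv/= -ler_norml normrM normfV (gtr0_norm b20) ler_pdivrMr// mul1r.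
have E : (dickson k).[x] = 2 * b ^+ k * cos (k%:R * t) /\
    (dickson k.+1).[x] = 2 * b ^+ k.+1 * cos (k.+1%:R * t).
  elim: k => [|k [IH1 IH2]].
    by rewrite /dickson /= hornerC mul0r cos0 mul1r expr0 expr1 !mulr1.
  split => //; have -> : (dickson k.+2).[x] =
      W.[x] * (dickson k.+1).[x] - b ^+ 2 * (dickson k).[x].
    by rewrite dicksonSS !hornerE.
  rewrite IH1 IH2 WE.
  have -> : k%:R * t = k.+1%:R * t - t by rewrite -natr1; ring.
  have -> : k.+2%:R * t = k.+1%:R * t + t by rewrite -[in LHS]natr1; ring.
  by rewrite cosB cosD ![b ^+ _.+1]exprS; ring.
have p0 : 0 <= 2 * b ^+ k by rewrite mulr_ge0// exprn_ge0// ltW.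
rewrite E.1 normrM ger0_norm// ler_piMr//.
by rewrite ler_norml cos_geN1 cos_le1.
Qed.

(** The constant [dickson 0 = 2] is replaced by 1, to have a monic polynomial of degree exactly
    [j]. *)
Definition dickson_basis j : {poly R} :=
  'X^(j %% m) * (if (j %/ m)%N is k.+1 then dickson k.+1 else 1).

Lemma dickson_basis_monic j : dickson_basis j \is monic.
Proof.
rewrite /dickson_basis monicMl ?monicXn//; case: (j %/ m)%N => [|k]; first exact: monic1.
by have /andP[] := dickson_monic_size k.
Qed.

Lemma size_dickson_basis j : size (dickson_basis j) = j.+1.
Proof.
rewrite /dickson_basis; have := divn_eq j m; case: (j %/ m)%N => [|k] jE.
  by rewrite mulr1 size_polyXn {2}jE mul0n.
have /andP[mon /eqP s] := dickson_monic_size k.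
rewrite size_monicM ?monicXn ?monic_neq0// size_polyXn s [in RHS]jE.
by rewrite addSn /= addnS mulnC addnC.
Qed.

Lemma dickson_basis_bound j x : `|x| <= 1 -> `|W.[x]| <= 2 * b ->
  `|(dickson_basis j).[x]| <= 2 * b ^+ (j %/ m).
Proof.
move=> x1 Wx; rewrite /dickson_basis hornerM hornerXn normrM normrX.
rewrite -[leRHS]mul1r ler_pM ?exprn_ge0 ?exprn_ile1//.
case: (j %/ m)%N => [|k]; last exact: dickson_bound.
by rewrite hornerC normr1 expr0 mulr1 ler1n.
Qed.

End Dickson.

(** * Vandermonde bound and passage to the limit *)

Section LowerBound.
Variable R : realType.

Lemma ln_prod (I : Type) (r : seq I) (P : pred I) (F : I -> R) :
  (forall i, P i -> 0 < F i) ->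
  ln (\prod_(i <- r | P i) F i) = \sum_(i <- r | P i) ln (F i) /\
  0 < \prod_(i <- r | P i) F i.
Proof.
move=> F0; apply: (big_ind2 (fun y s => ln y = s /\ 0 < y)).
- by rewrite ln1.
- by move=> y s z t [<- y0] [<- z0]; rewrite lnM ?mulr_gt0.
- by move=> i /F0.
Qed.

Variables (W : {poly R}) (b : R) (m : nat) (A : set R).
Hypotheses (Wmon : W \is monic) (sW : size W = m.+1) (m0 : (0 < m)%N) (b0 : 0 < b).
Hypotheses (A1 : A `<=` [set x | -1 <= x <= 1]) (AW : forall x, A x -> `|W.[x]| <= 2 * b).

Lemma Vandermonde_le M (x : 'I_(m * M) -> R) : (forall i, A (x i)) ->
  \prod_(i < m * M) \prod_(j < m * M | (i < j)%N) `|x j - x i| <=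
  (m * M)`!%:R * \prod_(j < m * M) (2 * b ^+ (j %/ m)).
Proof.
move=> Ax.
have := det_monic_Vandermonde x (dickson_basis_monic Wmon sW m0 b0)
  (size_dickson_basis Wmon sW m0 b0).
move=> /(congr1 Num.norm); rewrite normr_prod.
under eq_bigr do rewrite normr_prod.
move=> <-; apply: normr_det_le => i j; rewrite mxE.
by apply: dickson_basis_bound => //; [rewrite ler_norml; exact: A1|exact: AW].
Qed.

Hypothesis mA : measurable A.
Variable mu : probability R R.
Hypothesis muA : mu (~` A) = 0%E.

(** With [N = m M] points the degrees fill complete blocks. The logarithm of the Vandermonde bound
    is combined with the averaged pair sum, and the result is multiplied by [2 / N]. *)
Lemma log_energy_ge_discrete (e : R) M : log_energy mu = e%:E -> (0 < M)%N ->
  (m * M - m)%:R * (- ln b / m%:R) <=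
  (m * M).-1%:R * e + 2 + 2 * ln 2 + 2 * ln (m * M)%:R.
Proof.
move=> eE M0; set N := (m * M)%N.
have N0 : (0 < N)%N by rewrite muln_gt0 m0.
have posE : pos_energy mu = (e + ln 2)%:E.
  have := log_energyE mA muA A1; rewrite eE => /eqP.
  by case: (pos_energy mu) => //= r /eqP[->]; rewrite subrK.
have [//|x Ax] := @exists_pairwise_sum_le _ _ _ mu A mA muA (@poskernel R)
  (@measurable_poskernel R) (@poskernel_ge0 R) N (cst 0%E) (measurable_cst _).
rewrite big1// add0e integral0 mule0 add0e -/(pos_energy mu) posE -EFinM -EFinD => sum_le.
have G0 i j : (0 <= poskernel (x i) (x j))%E by exact: poskernel_ge0.
(* Coinciding points would make the pair sum infinite, against [sum_le]. *)
have xN (i j : 'I_N) : (i < j)%N -> x j - x i != 0.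
  move=> ij; rewrite subr_eq0; apply/eqP => xij.
  have : (poskernel (x i) (x j) <= \sum_(i < N) \sum_(j < N | (i < j)%N) poskernel (x i) (x j))%E.
    rewrite (bigD1 i)//= (bigD1 j)//= -addeA leeDl// adde_ge0// sume_ge0// => k _.
    by rewrite sume_ge0.
  move=> /le_trans/(_ sum_le); rewrite poskernelE; [|exact: A1|exact: A1].
  by rewrite /logkernel xij eqxx addye.
have kE (i j : 'I_N) : (i < j)%N -> poskernel (x i) (x j) = (ln 2 - ln `|x j - x i|)%:E.
  move=> ij; rewrite poskernelE; [|exact: A1|exact: A1].
  rewrite /logkernel ifF; first by rewrite -EFinD addrC distrC.
  by apply/negbTE; rewrite eq_sym -subr_eq0 xN.
move: sum_le; under eq_bigr do (under eq_bigr => ? ? do rewrite kE//).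
under eq_bigr do rewrite sumEFin.
rewrite sumEFin lee_fin.
have [lnP P0] : ln (\prod_(i < N) \prod_(j < N | (i < j)%N) `|x j - x i|) =
    \sum_(i < N) \sum_(j < N | (i < j)%N) ln `|x j - x i| /\
    0 < \prod_(i < N) \prod_(j < N | (i < j)%N) `|x j - x i|.
  have H (i : 'I_N) : ln (\prod_(j < N | (i < j)%N) `|x j - x i|) =
      \sum_(j < N | (i < j)%N) ln `|x j - x i| /\
      0 < \prod_(j < N | (i < j)%N) `|x j - x i|.
    by apply: ln_prod => j ij; rewrite normr_gt0 xN.
  under [X in _ = X /\ _]eq_bigr => i _ do rewrite -(H i).1.
  by apply: ln_prod => i _; exact: (H i).2.
have card_pairs (c : R) : \sum_(i < N) \sum_(j < N | (i < j)%N) c = 'C(N, 2)%:R * c.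
  rewrite (exchange_big_dep xpredT)//=.
  transitivity (\sum_(j < N) j%:R * c); last first.
    by rewrite -mulr_suml -natr_sum -bin2_sum big_mkord.
  apply: eq_bigr => j _; rewrite -(big_ord_widen N (fun _ => c)) 1?ltnW//.
  by rewrite sumr_const card_ord mulr_natl.
under eq_bigr do rewrite sumrB.
rewrite sumrB card_pairs -lnP => sum_le.
have := Vandermonde_le Ax; rewrite -/N -ler_ln ?posrE//; last first.
  by rewrite mulr_gt0 ?ltr0n ?fact_gt0// prodr_gt0// => i _; rewrite mulr_gt0// exprn_gt0.
have [lnB B0] := @ln_prod _ (index_enum 'I_N) xpredT (fun j : 'I_N => 2 * b ^+ (j %/ m))
  (fun j _ => mulr_gt0 (ltr0Sn _ 1) (exprn_gt0 _ b0)).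
rewrite lnM ?posrE ?ltr0n ?fact_gt0// lnB.
have -> : \sum_(j < N) ln (2 * b ^+ (j %/ m)) = N%:R * ln 2 + (\sum_(j < N) (j %/ m))%:R * ln b.
  rewrite (eq_bigr (fun j : 'I_N => ln 2 + (j %/ m)%:R * ln b)) => [|j _]; last first.
    by rewrite lnM ?posrE ?exprn_gt0// lnXn// mulr_natl.
  rewrite big_split /= sumr_const card_ord mulr_natl; congr (_ + _).
  by rewrite natr_sum mulr_suml.
have lnfact : ln N`!%:R <= N%:R * ln N%:R :> R.
  rewrite mulr_natl -lnXn ?ltr0n// ler_ln ?posrE ?exprn_gt0 ?ltr0n ?fact_gt0//.
  rewrite -natrX ler_nat; elim: (N) => // k IHk; rewrite factS expnS leq_mul2l /=.
  by rewrite (leq_trans IHk)//; case: k {IHk} => // k; rewrite leq_exp2r.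
have binE : 2 * 'C(N, 2)%:R = N%:R * N.-1%:R :> R.
  by rewrite -natrM mulnC -[2%N]/(2`!) bin_ffact ffactnS ffactn1 natrM.
have sumE : 2 * (\sum_(j < N) (j %/ m))%:R = N%:R * (M%:R - 1) :> R.
  rewrite -[1 in RHS]/(1%:R) -natrB// subn1.
  by rewrite -!natrM sum_divn_ord// mulnA.
have NR0 : 0 < N%:R :> R by rewrite ltr0n.
move=> V_le; rewrite -(ler_pM2l NR0).
have -> : N%:R * ((N - m)%:R * (- ln b / m%:R)) =
    - 2 * (\sum_(j < N) (j %/ m))%:R * ln b.
  rewrite !mulNr sumE /N natrB ?leq_pmulr// natrM; field.
  by rewrite pnatr_eq0 -lt0n.
rewrite !mulrDr [N%:R * (N.-1%:R * e)]mulrA -binE.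
lra.
Qed.

Lemma log_energy_ge : ((- ln b / m%:R)%:E <= log_energy mu)%E.
Proof.
set V := - ln b / m%:R.
have pos0 : (0 <= pos_energy mu)%E.
  by apply: integral_ge0 => x _; apply: integral_ge0 => y _; exact: poskernel_ge0.
case eE : (log_energy mu) => [e| |]; last 2 first.
- by rewrite leey.
- have := log_energyE mA muA A1; rewrite eE.
  by case: (pos_energy mu) pos0.
rewrite lee_fin leNgt; apply/negP => eV.
pose d := V - e; have d0 : 0 < d by rewrite subr_gt0.
(* The discrete inequality and [2 ln N < N d / 2 - 2 ln (d / 4)] give [N d / 2 < c]; [M] is taken
   large enough to contradict this. *)
pose c := d + (m%:R - 1) * V + 2 + 2 * ln 2 - 2 * ln (d / 4).
pose M := Num.bound `|2 * c / d|.
have cM : 2 * c < M%:R * d.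
  rewrite -ltr_pdivrMr// (le_lt_trans (ler_norm _))//.
  by apply: archi_boundP.
have M0 : (0 < M.+1)%N by [].
have := log_energy_ge_discrete eE M0.
have mM : (m <= m * M.+1)%N by rewrite leq_pmulr.
have N0 : (0 < m * M.+1)%N by rewrite muln_gt0 m0.
rewrite natrB// -subn1 natrB// -/V.
set N := (m * M.+1)%:R.
have N0' : 0 < N by rewrite ltr0n.
have NM : M%:R < N by rewrite ltr_nat; nia.
have : ln (N * (d / 4)) < N * (d / 4) by apply: ln_sublinear; rewrite mulr_gt0// divr_gt0.
rewrite lnM ?posrE ?divr_gt0//.
have : M%:R * d < N * d by rewrite ltr_pM2r.
rewrite /c /d in cM *; lra.
Qed.

End LowerBound.

(** * The equilibrium measure *)

Section Mixture.
Context d (T : measurableType d) (R : realType) (P : probability T R).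
Variables (m : nat) (f : nat -> {RV P >-> R}).

(** The law of [f J] for a uniform index [J] independent of the sample point; applied to the root
    branches, it is the law of a random root. *)
Definition mixture : set R -> \bar R :=
  mscale (m.+1%:R^-1)%:nng (msum (fun j => distribution P (f j)) m.+1).

HB.instance Definition _ := Measure.on mixture.

Let mixture_setT : mixture setT = 1%E.
Proof.
rewrite /mixture /mscale/= /msum.
rewrite (eq_bigr (fun=> 1%E)) => [|k _]; last exact: probability_setT.
rewrite sumEFin sumr_const card_ord -EFinM mulVf//.
Qed.

HB.instance Definition _ := Measure_isProbability.Build _ _ _ mixture mixture_setT.

Lemma mixture_null (A : set R) : (forall j x, A (f j x)) -> mixture (~` A) = 0%E.
Proof.
move=> Af; rewrite /mixture /mscale/= /msum big1 ?mule0// => j _.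
change (P (f j @^-1` (~` A)) = 0%E).
rewrite (_ : _ @^-1` _ = set0) ?measure0//.
by apply/seteqP; split => // x /=; apply; exact: Af.
Qed.

Lemma ge0_integral_mixture (g : R -> \bar R) :
  measurable_fun setT g -> (forall x, 0 <= g x)%E ->
  (\int[mixture]_x g x = (m.+1%:R^-1)%:E * \int[P]_x \sum_(j < m.+1) g (f j x))%E.
Proof.
move=> mg g0; rewrite ge0_integral_mscale//=.
rewrite ge0_integral_measure_sum//; congr (_ * _)%E.
rewrite ge0_integral_sum//; last by move=> j; exact: measurableT_comp.
by apply: eq_bigr => j _; rewrite ge0_integral_distribution.
Qed.

End Mixture.

(** * Root branches and a measure of small energy *)

Section UpperBound.
Variables (R : realType) (p : {poly R}) (m : nat).
Local Notation a := (lead_coef p).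
Hypothesis sp : size p = m.+2.

(** The inclusion of [K] in [[-1, 1]] enters the argument in this form; [r] lists roots with
    multiplicity. *)
Definition real_rooted_on01 := forall s, 0 <= s <= 1 -> exists r : seq R,
  [/\ size r = m.+1, {in r, forall y, -1 <= y <= 1} &
      p - s%:P = a *: \prod_(y <- r) ('X - y%:P)].

Hypothesis pr : real_rooted_on01.

Let a0 : a != 0.
Proof. by rewrite lead_coef_eq0 -size_poly_eq0 sp. Qed.

(** Sorting makes each position in the list a definite function of [s]. The empty list is the
    default when no such list exists. *)
Definition sorted_roots (s : R) : seq R := xget [::] [set r : seq R |
  [/\ sorted <=%R r, size r = m.+1, {in r, forall y, -1 <= y <= 1} &
      p - s%:P = a *: \prod_(y <- r) ('X - y%:P)]].

Lemma sorted_rootsP s : 0 <= s <= 1 ->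
  [/\ sorted <=%R (sorted_roots s), size (sorted_roots s) = m.+1,
      {in sorted_roots s, forall y, -1 <= y <= 1} &
      p - s%:P = a *: \prod_(y <- sorted_roots s) ('X - y%:P)].
Proof.
move=> s01; have [r [sr r1 rE]] := pr s01.
suff H : [set r : seq R | [/\ sorted <=%R r, size r = m.+1,
    {in r, forall y, -1 <= y <= 1} &
    p - s%:P = a *: \prod_(y <- r) ('X - y%:P)]] (sort <=%R r).
  by have := xgetPex [::] (ex_intro _ _ H).
split.
- exact: sort_le_sorted.
- by rewrite size_sort.
- by move=> y; rewrite mem_sort; exact: r1.
- by rewrite rE; congr (_ *: _); apply/perm_big; rewrite perm_sym perm_sort.
Qed.

Lemma prod_sorted_roots s : 0 <= s <= 1 ->
  p - s%:P = a *: \prod_(i < m.+1) ('X - (nth 0 (sorted_roots s) i)%:P).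
Proof.
move=> /sorted_rootsP[_ sY _ ->].
by rewrite (big_nth 0) sY big_mkord.
Qed.

Lemma poly_ext (q r : {poly R}) : (forall x, q.[x] = r.[x]) -> q = r.
Proof.
move=> qr; apply/eqP; rewrite -subr_eq0; apply: contraT => qrN0.
pose rs : seq R := [seq i%:R | i <- iota 0 (size (q - r))].
have : (size rs < size (q - r)%R)%N.
  apply: max_poly_roots => //.
    by apply/allP => x _; rewrite rootE !hornerE qr subrr.
  rewrite map_inj_uniq ?iota_uniq// => i j /eqP; rewrite eqr_nat => /eqP //.
by rewrite size_map size_iota ltnn.
Qed.

Lemma continuous_prod_sub (t : R) :
  continuous (fun v : 'rV[R]_m.+1 => \prod_(i < m.+1) (t - v ord0 i)).
Proof.
apply: continuous_big; first exact: mul_continuous.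
move=> i _ v; apply: (@continuousB _ _ _ (cst t) (fun v : 'rV[R]_m.+1 => v ord0 i)).
  exact: cst_continuous.
exact: coord_continuous.
Qed.

Lemma continuous_affine_prod_sub (c : 'rV[R]_m.+1 -> R) (b t : R) : continuous c ->
  continuous (fun v : 'rV[R]_m.+1 => c v + b * \prod_(i < m.+1) (t - v ord0 i)).
Proof.
move=> cc v; apply: (@continuousD _ _ _ c
  (fun v : 'rV[R]_m.+1 => b * \prod_(i < m.+1) (t - v ord0 i))); first exact: cc.
apply: (@continuousM _ _ (cst b) (fun v : 'rV[R]_m.+1 => \prod_(i < m.+1) (t - v ord0 i))).
  exact: cst_continuous.
exact: continuous_prod_sub.
Qed.

(** Were the entry at [j] above [c], all later ones would be too, leaving at most [j] entries
    below. *)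
Lemma sorted_nth_le (s : seq R) (c : R) j : sorted <=%R s -> (j < size s)%N ->
  (j < count (fun y => (y <= c)%R) s)%N -> nth 0 s j <= c.
Proof.
move=> so js; apply: contraTT; rewrite -ltNge -leqNgt => cj.
rewrite -(cat_take_drop j s) count_cat.
rewrite [X in (_ + X)%N](_ : _ = 0%N); last first.
  apply/eqP; rewrite -leqn0 leqNgt -has_count -all_predC.
  apply/(all_nthP 0) => i; rewrite size_drop => ij /=; rewrite -ltNge nth_drop.
  apply: (lt_le_trans cj); apply: (sorted_leq_nth le_trans le_refl) => //; rewrite ?inE ?leq_addr//.
  by rewrite -ltn_subRL.
by rewrite addn0 (leq_trans (count_size _ _))// size_takel// ltnW.
Qed.

(* The roots depend on [s] through the compact set of root vectors of the
   polynomials [p - s], on which [s] is a continuous function. *)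
Lemma sorted_roots_closed j c : (j < m.+1)%N ->
  closed [set s | 0 <= s <= 1 /\ nth 0 (sorted_roots s) j <= c].
Proof.
move=> jm.
(* Vectors in the box may be unsorted: [j.+1] coordinates at most [c] already force the sorted root
   at position [j] to be at most [c]. *)
pose box := [set v : 'rV[R]_m.+1 | forall i : 'I_m.+1,
  `[-1, if (i <= j)%N then Num.min c 1 else 1]%classic (v ord0 i)].
(* [sv] recovers [s] from a root vector by evaluating [p - s] at 0. The equations [Ft t v = p.[t]]
   for all [t] then say that [v] lists the roots of [p - sv v]. *)
pose sv (v : 'rV[R]_m.+1) := p.[0] + - a * \prod_(i < m.+1) (0 - v ord0 i).
pose Ft (t : R) (v : 'rV[R]_m.+1) := sv v + a * \prod_(i < m.+1) (t - v ord0 i).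
have csv : continuous sv.
  by apply: (@continuous_affine_prod_sub (cst p.[0])); exact: cst_continuous.
have cFt t : continuous (Ft t) by exact: continuous_affine_prod_sub.
pose E := box `&` (sv @^-1` `[0, 1]%classic `&` \bigcap_t (Ft t @^-1` [set p.[t]])).
have cE : compact E.
  apply: compact_closedI.
    apply: (@rV_compact _ _ (fun i : 'I_m.+1 =>
      `[-1, if (i <= j)%N then Num.min c 1 else 1]%classic)) => i.
    exact: segment_compact.
  apply: closedI.
    by apply: preimage_closed => //; exact: itv_closed.
  apply: closed_bigI => t _; apply: preimage_closed => //; exact: closed_eq.
suff -> : [set s | 0 <= s <= 1 /\ nth 0 (sorted_roots s) j <= c] = sv @` E.
  apply: compact_closed; first exact: Rhausdorff.
  by apply: continuous_compact => //; exact: continuous_subspaceT.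
apply/seteqP; split => [s [s01 sj]|_ [v [vbox [sv01 vF]] <-]] /=.
  have [so sY Y1 _] := sorted_rootsP s01.
  have pE t : p.[t] - s = a * \prod_(i < m.+1) (t - nth 0 (sorted_roots s) i).
    have /(congr1 (fun q => q.[t])) := prod_sorted_roots s01.
    rewrite hornerD hornerN hornerC hornerZ horner_prod => ->.
    by congr (_ * _); apply: eq_bigr => i _; rewrite hornerXsubC.
  pose v : 'rV[R]_m.+1 := \row_i nth 0 (sorted_roots s) i.
  have vE t : \prod_(i < m.+1) (t - v ord0 i) = \prod_(i < m.+1) (t - nth 0 (sorted_roots s) i).
    by apply: eq_bigr => i _; rewrite mxE.
  have svE : sv v = s by rewrite /sv vE mulNr -pE; ring.
  exists v => //; split.
    move=> i; rewrite /= mxE in_itv/=.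
    have /andP[-> y1] : -1 <= nth 0 (sorted_roots s) i <= 1.
      by apply: Y1; rewrite mem_nth// sY.
    case: ifPn => // ij; rewrite le_min y1 andbT (le_trans _ sj)//.
    by apply: (sorted_leq_nth le_trans le_refl) => //; rewrite ?inE sY.
  split; first by rewrite /= svE in_itv.
  by move=> t _; rewrite /= /Ft svE vE -pE; ring.
have s01 : 0 <= sv v <= 1 by move: sv01; rewrite /= in_itv.
split=> //; set s := sv v in s01 *.
have [so sY _ pE] := sorted_rootsP s01.
pose vs := [seq v ord0 i | i <- enum 'I_m.+1].
have pE' : p - s%:P = a *: \prod_(y <- vs) ('X - y%:P).
  apply: poly_ext => t; rewrite hornerD hornerN hornerC hornerZ horner_prod.
  rewrite big_map big_enum/= -(vF t Logic.I) /Ft -/s addrAC subrr add0r.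
  by congr (_ * _); apply: eq_bigr => i _; rewrite hornerXsubC.
have /prod_XsubC_eq/seq.permP ct :
    \prod_(y <- sorted_roots s) ('X - y%:P) = \prod_(y <- vs) ('X - y%:P).
  by apply: (scalerI a0); rewrite -pE -pE'.
apply: sorted_nth_le => //; first by rewrite sY.
rewrite ct count_map -size_filter.
have -> : size [seq x <- enum 'I_m.+1 | preim (fun i => v ord0 i) (fun y => y <= c) x] =
    #|[pred i | v ord0 i <= c]|.
  by rewrite size_filter -sum1_count -sum1_card big_enum_cond.
have -> : j.+1 = #|[pred i : 'I_m.+1 | (i < j.+1)%N]|.
  rewrite -sum1_card -[LHS]card_ord -sum1_card.
  by rewrite (big_ord_widen m.+1 (fun _ => 1%N)).
apply/subset_leq_card/fintype.subsetP => i; rewrite !inE ltnS => ij.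
have := vbox i; rewrite /= in_itv/= ij => /andP[_].
by rewrite le_min => /andP[].
Qed.

Lemma measurable_sorted_roots j : measurable_fun [set: R]
  (fun t => if (j < m.+1)%N then nth 0 (sorted_roots (cosunit t)) j else 0).
Proof.
case: ltnP => [jm|_]; last exact: measurable_cst.
apply: (measurability (@RGenOInfty.G R)); first exact: RGenOInfty.measurableE.
move=> _ [_ [c ->] <-]; rewrite setTI.
rewrite (_ : _ @^-1` _ = ~` (@cosunit R @^-1`
    [set s | 0 <= s <= 1 /\ nth 0 (sorted_roots s) j <= c])); last first.
  apply/seteqP; split => t /=; rewrite in_itv/= andbT.
    by move=> ct [_]; rewrite leNgt ct.
  by move=> H; rewrite ltNge; apply/negP => h; apply: H; split => //; exact: cosunit_itv.
apply: measurableC; apply: closed_measurable.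
apply: preimage_closed; last exact: sorted_roots_closed.
by move=> t _; exact: cosunit_continuous.
Qed.

Let U : probability (measurableTypeR R) R := uniform_prob (@ltr01 R).

Definition root_branch (j : nat) (t : measurableTypeR R) : R :=
  if (j < m.+1)%N then nth 0 (sorted_roots (cosunit t)) j else 0.

Lemma measurable_root_branch j : measurable_fun [set: measurableTypeR R] (root_branch j).
Proof. exact: (measurable_sorted_roots j). Qed.

Lemma sum_poskernel_roots (x s : R) : -1 <= x <= 1 -> 0 <= s <= 1 ->
  (\sum_(j < m.+1) poskernel x (nth 0%R (sorted_roots s) j) =
   logkernel p.[x] s + (ln `|a| + m.+1%:R * ln 2)%:E)%E.
Proof.
move=> x1 s01; have [_ sY Y1 _] := sorted_rootsP s01.
have pE : p.[x] - s = a * \prod_(i < m.+1) (x - nth 0 (sorted_roots s) i).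
  have /(congr1 (fun q => q.[x])) := prod_sorted_roots s01.
  rewrite hornerD hornerN hornerC hornerZ horner_prod => ->.
  by congr (_ * _); apply: eq_bigr => i _; rewrite hornerXsubC.
have kE (j : 'I_m.+1) : poskernel x (nth 0 (sorted_roots s) j) =
    (logkernel x (nth 0%R (sorted_roots s) j) + (ln 2)%:E)%E.
  by rewrite poskernelE//; apply: Y1; rewrite mem_nth// sY.
rewrite /logkernel -(subr_eq0 p.[x]).
(* When [p.[x] = s], some root equals [x] and both sides are infinite; otherwise the factorization
   of [p.[x] - s] is turned into a sum of logarithms. *)
have [xs|xsN0] := eqVneq (p.[x] - s) 0.
  move: pE; rewrite xs => /esym/eqP; rewrite mulf_eq0 (negbTE a0)/=.
  rewrite prodf_seq_eq0 => /hasP[j _ /=]; rewrite subr_eq0 => /eqP xj.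
  rewrite (bigD1 j)//= kE /logkernel -xj eqxx !addye// gt_eqF// (lt_le_trans (ltNy0))//.
  by apply: sume_ge0 => k _; exact: poskernel_ge0.
have prodN0 : \prod_(i < m.+1) (x - nth 0 (sorted_roots s) i) != 0.
  by apply: contra_neq xsN0 => h; rewrite pE h mulr0.
have xN (j : 'I_m.+1) : x - nth 0 (sorted_roots s) j != 0.
  by apply: contra_neq prodN0 => h; rewrite (bigD1 j)//= h mul0r.
under eq_bigr => j _.
  rewrite kE /logkernel -subr_eq0 (negbTE (xN j)) -EFinD.
  over.
rewrite sumEFin -EFinD; congr EFin.
rewrite big_split/= sumrN sumr_const card_ord mulr_natl.
have [|<- p0] := @ln_prod _ _ (index_enum 'I_m.+1) xpredT
  (fun j => `|x - nth 0 (sorted_roots s) j|).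
  by move=> j _; rewrite normr_gt0.
by rewrite pE normrM normr_prod lnM ?posrE ?normr_gt0//; ring.
Qed.

Local Notation A := [set x : R | 0 <= p.[x] <= 1].

Lemma sublevel_itv : A `<=` [set x | -1 <= x <= 1].
Proof.
move=> x /= px; have [r [_ r1 pE]] := pr px.
apply: r1; rewrite -root_prod_XsubC rootE.
have /(congr1 (fun q => q.[x])) := pE.
rewrite hornerD hornerN hornerC subrr hornerZ => /esym/eqP.
by rewrite mulf_eq0 (negbTE a0).
Qed.

Lemma sublevel_measurable : measurable A.
Proof.
rewrite (_ : A = horner p @^-1` `[0, 1]%classic); last first.
  by apply/seteqP; split => x /=; rewrite in_itv.
by rewrite -[X in measurable X]setTI; exact: measurable_poly.
Qed.

Lemma exists_log_energy_le : exists2 mu : probability R R,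
  mu (~` A) = 0%E & (log_energy mu <= ((ln 4 + ln `|a|) / m.+1%:R)%:E)%E.
Proof.
(* Indices beyond [m] are redirected to branch 0, so that every [f j] is a root, as [mixture_null]
   asks for all [j]. *)
pose f j : {RV U >-> R} := HB.pack (root_branch (if (j < m.+1)%N then j else 0%N))
  (isMeasurableFun.Build _ _ _ _ _ (measurable_root_branch (if (j < m.+1)%N then j else 0%N))).
have fE j t : (j < m.+1)%N -> f j t = nth 0 (sorted_roots (cosunit t)) j.
  by move=> jm; rewrite /f /= /root_branch !jm.
have fA j x : A (f j x).
  have [i [im ->]] : exists i, (i < m.+1)%N /\ f j x = nth 0 (sorted_roots (cosunit x)) i.
    exists (if (j < m.+1)%N then j else 0%N); rewrite /f /= /root_branch.
    by case: ifP => // ->.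
  have [_ sY _ pE] := sorted_rootsP (cosunit_itv x).
  rewrite /= (_ : p.[_] = cosunit x); first exact: cosunit_itv.
  apply/eqP; rewrite -subr_eq0.
  have /(congr1 (fun q => q.[nth 0 (sorted_roots (cosunit x)) i])) := pE.
  rewrite hornerD hornerN hornerC hornerZ => ->.
  have /eqP -> : root (\prod_(y <- sorted_roots (cosunit x)) ('X - y%:P))
      (nth 0 (sorted_roots (cosunit x)) i).
    by rewrite root_prod_XsubC mem_nth// sY.
  by rewrite mulr0.
exists (mixture m f); first exact: mixture_null.
rewrite (@log_energyE _ _ A sublevel_measurable); [|exact: mixture_null|exact: sublevel_itv].
suff : (pos_energy (mixture m f) <= ((ln 4 + ln `|a|) / m.+1%:R + ln 2)%:E)%E.
  move=> h; rewrite leeBlDr//.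
rewrite /pos_energy.
have mU : measurable_fun setT (fun x => \int[mixture m f]_y poskernel x y)%E.
  exact: (measurable_kernel_potential _ (@measurable_poskernel R) (@poskernel_ge0 R)).
have U0 x : (0 <= \int[mixture m f]_y poskernel x y)%E.
  by apply: integral_ge0 => y _; exact: poskernel_ge0.
rewrite (@ge0_negligible_integral _ _ _ _ setT (~` A))//; last 2 first.
- by apply: measurableC; exact: sublevel_measurable.
- exact: mixture_null.
rewrite setDE setCK setTI.
set V := (_ + _)%:E%E.
have <- : (\int[mixture m f]_(y in A) cst V y = V)%E.
  rewrite integral_cst//; last exact: sublevel_measurable.
  rewrite -[RHS]mule1; congr (_ * _)%E; apply: probability_full; first exact: sublevel_measurable.
  exact: mixture_null.
apply: ge0_le_integral => //; first exact: sublevel_measurable.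
  exact: measurable_funTS.
move=> x Ax.
have x1 := sublevel_itv Ax.
rewrite ge0_integral_mixture; last 2 first.
- exact: (measurable_kernel_section (@measurable_poskernel R)).
- by move=> y; exact: poskernel_ge0.
under eq_integral => t _.
  under eq_bigr => j _ do rewrite fE//.
  rewrite (sum_poskernel_roots x1 (cosunit_itv t)).
  over.
have L0 t : (0 <= logkernel p.[x] (cosunit t))%E.
  rewrite /logkernel; case: ifP => // _; rewrite lee_fin oppr_ge0 ln_le0//.
  by have := cosunit_itv t; move: Ax; rewrite /= ler_norml; lra.
have mL : measurable_fun setT (fun t : measurableTypeR R => logkernel p.[x] (cosunit t)).
  apply: (measurableT_comp (measurableT_comp (@measurable_logkernel R) (pair1_measurable p.[x]))).
  by apply: continuous_measurable_fun; exact: cosunit_continuous.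
rewrite integral_addr_cst// integral_uniform// subr0 invr1 mul1e.
have [u u01 <-] := cosunit_surj Ax.
have := integral_logkernel_cosunit u01.
rewrite /V => I_le.
apply: (@le_trans _ _ ((m.+1%:R^-1)%:E * ((2 * ln 2)%:E + (ln `|a| + m.+1%:R * ln 2)%:E))%E).
  by rewrite lee_wpmul2l// leeD2r.
rewrite -EFinD -EFinM lee_fin le_eqVlt; apply/orP; left; apply/eqP.
have -> : ln 4 = 2 * ln 2 :> R.
  by rewrite (_ : 4 = 2 ^+ 2) ?lnXn// ?mulr_natl//; ring.
have : m.+1%:R != 0 :> R by rewrite pnatr_eq0.
by set M := m.+1%:R => M0; field.
Qed.

End UpperBound.

(** * Capacity and Chebyshev polynomial *)

Local Open Scope complex_scope.

Section RealCase.
Variables (R : realType) (p : {poly R}) (m : nat).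
Local Notation a := (lead_coef p).
Local Notation toC := (map_poly (real_complex R)).
Local Notation K := (preim01 (toC p)).
Hypothesis sp : size p = m.+2.
Hypothesis pr : real_rooted_on01 p m.

Let a0 : a != 0.
Proof. by rewrite lead_coef_eq0 -size_poly_eq0 sp. Qed.

Let mem_K (x : R) : K x%:C = (0 <= p.[x] <= 1) :> Prop.
Proof.
rewrite /preim01 /in_real_segment /= horner_map /=.
by apply/propext; split => [[]|].
Qed.

Let K_real (z : R[i]) : K z -> exists x : R, z = x%:C.
Proof.
case=> Im0 s01; set s := complex.Re _ in s01.
have pz : (toC p).[z] = s%:C by apply/eqP; rewrite eq_complex /= eqxx Im0 /=.
have [r [_ _ /(congr1 (fun q => (toC q).[z]))]] := pr s01.
rewrite rmorphB /= map_polyC /= hornerD hornerN hornerC pz subrr map_polyZ hornerZ.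
move/esym/eqP; rewrite mulf_eq0 fmorph_eq0 (negbTE a0) /= rmorph_prod horner_prod.
rewrite prodf_seq_eq0 => /hasP[y _ /=].
by rewrite rmorphB/= map_polyX map_polyC hornerXsubC subr_eq0 => /eqP ->; exists y.
Qed.

(** Centring at the midpoint of [[0, 1]] makes the bounds on [K] symmetric about 0; this is the
    expected minimizer. *)
Let W := a^-1 *: (p - 2^-1%:P).

Let sW : size W = m.+2.
Proof.
rewrite size_scale ?invr_eq0// size_polyDl ?size_polyN ?sp//.
by rewrite (leq_ltn_trans (size_polyC_leq1 _)).
Qed.

Let Wmon : W \is monic.
Proof.
rewrite monicE lead_coefZ lead_coefDl ?mulVf//.
by rewrite size_polyN sp (leq_ltn_trans (size_polyC_leq1 _)).
Qed.

(** The bound is written as [2 b] with [b = 1 / (4 |a|)], the form used with Dickson polynomials. *)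
Let W_le x : 0 <= p.[x] <= 1 -> `|W.[x]| <= 2 * (4 * `|a|)^-1.
Proof.
move=> px; rewrite hornerZ hornerD hornerN hornerC normrM normfV invfM mulrA mulrC.
rewrite ler_wpM2r ?invr_ge0//.
by rewrite (_ : 2 * 4^-1 = 2^-1); [rewrite ler_norml; lra|field].
Qed.

Lemma robin_constantE :
  robin_constant K = ((ln 4 + ln `|a|) / m.+1%:R)%:E.
Proof.
have trE : real_trace K = [set x : R | 0 <= p.[x] <= 1].
  by apply/funext => x; rewrite /real_trace /= mem_K.
rewrite /robin_constant trE; apply/eqP; rewrite eq_le; apply/andP; split.
  have [mu mu0 mu_le] := exists_log_energy_le sp pr.
  by apply: le_trans mu_le; apply: ereal_inf_lbound; exists mu.
apply: le_ereal_inf_tmp => _ [mu /= mu0 <-].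
have b0 : 0 < (4 * `|a|)^-1 by rewrite invr_gt0 mulr_gt0// normr_gt0.
have := @log_energy_ge R W _ m.+1 [set x : R | 0 <= p.[x] <= 1] Wmon sW (ltn0Sn _) b0
  (sublevel_itv sp pr) W_le (sublevel_measurable p) mu mu0.
by rewrite lnV ?posrE ?mulr_gt0 ?normr_gt0// opprK lnM ?posrE ?normr_gt0.
Qed.

Lemma CapE : Cap K ^+ m.+1 = (4 * `|a|)^-1.
Proof.
rewrite /Cap robin_constantE -expRM_natl -mulr_natl mulrN mulrC divfK ?pnatr_eq0//.
by rewrite expRN expRD !lnK ?posrE ?normr_gt0.
Qed.

(** The monic forms of [p] and [p - 1] differ by [a^-1], so [alternation_unique] applies to their
    roots with [d = a^-1]. *)
Lemma chebyshev_sup_le_unique (Q : {poly R[i]}) : Q \is monic -> size Q = m.+2 ->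
  (supnorm K Q <= `|a^-1 / 2|%:E)%E -> Q = toC W.
Proof.
move=> Qmon sQ Qle.
have [r0 [s0 r01 E0]] : exists r : seq R, [/\ size r = m.+1, {in r, forall y, -1 <= y <= 1} &
      p - 0%:P = a *: \prod_(y <- r) ('X - y%:P)] by apply: pr; rewrite lexx ler01.
have [r1 [s1 r11 E1]] : exists r : seq R, [/\ size r = m.+1, {in r, forall y, -1 <= y <= 1} &
      p - 1%:P = a *: \prod_(y <- r) ('X - y%:P)] by apply: pr; rewrite lexx ler01.
have rootE (r : seq R) y : y \in r -> (\prod_(z <- r) ('X - z%:P)).[y] = 0.
  by move=> yr; apply/rootP; rewrite root_prod_XsubC.
have prodE (r : seq R) s : p - s%:P = a *: \prod_(y <- r) ('X - y%:P) ->
    \prod_(y <- r) ('X - y%:P) = a^-1 *: (p - s%:P).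
  by move=> ->; rewrite scalerA mulVf// scale1r.
have memr (r : seq R) s y : 0 <= s <= 1 -> p - s%:P = a *: \prod_(y <- r) ('X - y%:P) ->
    y \in r -> K y%:C.
  move=> s01 /(congr1 (fun q => q.[y])) + yr; rewrite mem_K.
  rewrite hornerD hornerN hornerC hornerZ rootE// mulr0 => /eqP.
  by rewrite subr_eq0 => /eqP ->.
rewrite (alternation_unique s0 s1 (d := a^-1) (Q := Q)) ?invr_eq0//.
- by rewrite (prodE _ _ E0) subr0 /W scalerBr -!mul_polyC -polyCM.
- by rewrite (prodE _ _ E0) (prodE _ _ E1) -scalerBr subr0 opprD addrA subrr sub0r opprK alg_polyC.
- move=> y; rewrite mem_cat -lee_fin => yr; apply: le_trans Qle.
  apply: ereal_sup_ubound; exists y%:C => //.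
  by case/orP: yr; [apply: memr E0|apply: memr E1]; rewrite lexx ler01.
Qed.

Lemma chebyshev_of_real_rooted :
  is_chebyshev K m.+1 (toC W) /\ forall Q, is_chebyshev K m.+1 Q -> Q = toC W.
Proof.
have toCW_mon : toC W \is monic by rewrite map_monic.
have toCW_size : size (toC W) = m.+2 by rewrite size_map_poly.
have W_sup : (supnorm K (toC W) <= `|a^-1 / 2|%:E)%E.
  apply: ge_ereal_sup => _ [z Kz <-]; rewrite lee_fin.
  have [x zE] := K_real Kz; rewrite zE mem_K in Kz *.
  rewrite horner_map /cabs /= expr0n addr0 sqrtr_sqr (le_trans (W_le Kz))//.
  by rewrite normrM normfV [`|2^-1|]ger0_norm ?invr_ge0// invfM; lra.
(* A competitor of smaller norm would satisfy the same bound, hence equal [W], which is absurd. *)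
have min Q : Q \is monic -> size Q = m.+2 -> (supnorm K (toC W) <= supnorm K Q)%E.
  move=> Qmon sQ; rewrite leNgt; apply/negP => lt_Q.
  move: (lt_Q); rewrite {1}(chebyshev_sup_le_unique Qmon sQ) ?ltxx//.
  exact: le_trans (ltW lt_Q) W_sup.
split; first by split.
move=> Q [Qmon sQ Qmin]; apply: chebyshev_sup_le_unique => //.
exact: le_trans (Qmin _ toCW_mon toCW_size) W_sup.
Qed.

(** If [a > 0], then [p - 1] is positive at 2, beyond all its roots, so [p] takes the value 1/2
    between 1 and 2. Such a point lies in [[-1, 1]], hence is 1, where [p] vanishes. *)
Lemma lead_coef_lt0 : p.[1] = 0 -> a < 0.
Proof.
move=> p1; rewrite lt_neqAle a0/= leNgt; apply/negP => agt0.
have [r [sr r1 pE]] : exists r : seq R, [/\ size r = m.+1, {in r, forall y, -1 <= y <= 1} &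
      p - 1%:P = a *: \prod_(y <- r) ('X - y%:P)] by apply: pr; rewrite lexx ler01.
have p2 : 0 < p.[2] - 1.
  have /(congr1 (fun q => q.[2])) := pE; rewrite hornerD hornerN hornerC => ->.
  rewrite hornerZ mulr_gt0// horner_prod big_seq prodr_gt0// => y yr.
  by rewrite hornerXsubC; have := r1 y yr; lra.
have le12 : 1 <= 2 :> R by lra.
have sgn : (p - 2^-1%:P).[1] <= 0 <= (p - 2^-1%:P).[2].
  by rewrite !hornerD !hornerN !hornerC p1; apply/andP; split; lra.
have [x x12] := poly_ivt le12 sgn.
rewrite rootE hornerD hornerN hornerC subr_eq0 => /eqP px.
have : -1 <= x <= 1 by apply: (sublevel_itv sp pr); rewrite /= px; lra.
move: x12 => /andP[x1 _] /andP[_ x1'].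
have xE : x = 1 by lra.
by move: px; rewrite xE p1; lra.
Qed.

(** Mirror image, tested at -2: the product there has an odd number of negative factors. *)
Lemma lead_coef_gt0 : odd m.+1 -> p.[-1] = 0 -> 0 < a.
Proof.
move=> om p1; rewrite lt_neqAle eq_sym a0/= leNgt; apply/negP => alt0.
have [r [sr r1 pE]] : exists r : seq R, [/\ size r = m.+1, {in r, forall y, -1 <= y <= 1} &
      p - 1%:P = a *: \prod_(y <- r) ('X - y%:P)] by apply: pr; rewrite lexx ler01.
have p2 : 0 < p.[-2] - 1.
  have /(congr1 (fun q => q.[-2])) := pE; rewrite hornerD hornerN hornerC => ->.
  rewrite hornerZ -mulrNN mulr_gt0 ?oppr_gt0//.
  rewrite horner_prod (eq_bigr (fun y => -1 * (2 + y))) => [|y _]; last first.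
    by rewrite hornerXsubC; ring.
  rewrite big_split/= big_const_seq count_predT sr iter_mulr_1 -signr_odd om expr1 mulN1r.
  rewrite oppr_lt0 big_seq prodr_gt0// => y yr.
  by have := r1 y yr; lra.
have le21 : -2 <= -1 :> R by lra.
have sgn : (2^-1%:P - p).[-2] <= 0 <= (2^-1%:P - p).[-1].
  by rewrite !hornerD !hornerN !hornerC p1; apply/andP; split; lra.
have [x x12] := poly_ivt le21 sgn.
rewrite rootE hornerD hornerN hornerC subr_eq0 => /eqP px.
have : -1 <= x <= 1 by apply: (sublevel_itv sp pr); rewrite /= -px; lra.
move: x12 => /andP[_ x1] /andP[x1' _].
have xE : x = -1 by lra.
by move: px; rewrite xE p1; lra.
Qed.

End RealCase.

Lemma real_poly_of_preim01 (R : realType) m (P : {poly R[i]}) : size P = m.+2 ->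
  preim01 P `<=` in_real_segment (-1) 1 ->
  exists2 p : {poly R}, P = map_poly (real_complex R) p & real_rooted_on01 p m.
Proof.
move=> sP PK; set c := lead_coef P.
have c0 : c != 0 by rewrite lead_coef_eq0 -size_poly_eq0 sP.
have roots s : 0 <= s <= 1 -> exists r : seq R, [/\ size r = m.+1,
    {in r, forall y, -1 <= y <= 1} &
    P - (s%:C)%:P = c *: map_poly (real_complex R) (\prod_(y <- r) ('X - y%:P))].
  move=> s01; have [r rE] := closed_field_poly_normal (P - (s%:C)%:P).
  have lt_s : (size (- (s%:C)%:P : {poly R[i]})%R < size P)%N.
    by rewrite size_polyN sP (leq_ltn_trans (size_polyC_leq1 _)).
  rewrite lead_coefDl// -/c in rE.
  have rr z : z \in r -> z = (complex.Re z)%:C /\ -1 <= complex.Re z <= 1.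
    move=> zr; have [|Im0 ?] := PK z; last by split=> //; move: Im0; case: (z) => ? ? /= ->.
    have : root (P - (s%:C)%:P) z by rewrite rE rootZ// root_prod_XsubC.
    rewrite rootE hornerD hornerN hornerC subr_eq0 => /eqP Pz.
    by rewrite /preim01 /= Pz /in_real_segment.
  exists [seq complex.Re z | z <- r]; split.
  - have : size (P - (s%:C)%:P) = m.+2 by rewrite size_polyDl.
    by rewrite rE size_scale// size_prod_XsubC size_map => -[].
  - by move=> _ /mapP[z zr ->]; case: (rr z zr).
  - rewrite rE; congr (_ *: _); rewrite rmorph_prod big_map/= !big_seq.
    apply: eq_bigr => z zr; rewrite rmorphB/= map_polyX map_polyC /=.
    by rewrite -(rr z zr).1.
have [r0 [s0 _ E0]] := roots 0 (introT andP (conj (lexx 0) ler01)).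
have [r1 [s1 _ E1]] := roots 1 (introT andP (conj ler01 (lexx 1))).
set q0 := \prod_(y <- r0) _ in E0; set q1 := \prod_(y <- r1) _ in E1.
(* Subtracting the factorizations of [P] and [P - 1] shows that [c] times a real polynomial is 1, so
   [c] is real. *)
have cE : c = ((q0 - q1)`_0)^-1%:C.
  have : c *: map_poly (real_complex R) (q0 - q1) = 1.
    rewrite rmorphB/= scalerBr -E0 -E1 opprB addrC addrA subrK.
    by rewrite subr0.
  move=> /polyP/(_ 0%N); rewrite coefZ coef_map /= coef1 /= => h.
  rewrite fmorphV; apply: (mulIf (x := ((q0 - q1)`_0)%:C)).
    by apply: contra_eq_neq h => ->; rewrite mulr0 eq_sym oner_eq0.
  rewrite h mulVf//.
  by apply: contra_eq_neq h => ->; rewrite mulr0 eq_sym oner_eq0.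
set a := (_)^-1 in cE.
have lift q : c *: map_poly (real_complex R) q = map_poly (real_complex R) (a *: q).
  by rewrite cE map_polyZ.
have PE : P = map_poly (real_complex R) (a *: q0) by rewrite -lift -E0 subr0.
exists (a *: q0) => // s s01; have [r [sr r1' rE]] := roots s s01.
exists r; split => //; apply: (map_poly_inj (real_complex R)).
rewrite rmorphB /= -PE map_polyC /= rE lift; congr (map_poly _ (_ *: _)).
have : a%:C = (lead_coef (a *: q0))%:C by rewrite -cE -lead_coef_map -PE.
by move/complexI.
Qed.

Theorem theorem6 (R : realType) (n : nat) (S : {poly R[i]}) :
  (1 <= n)%N -> size S = n.+1 ->
  let c := lead_coef S in
  (let K := preim01 ((1 + 'X) * S ^+ 2) in
   K `<=` in_real_segment (-1) 1 ->
   let T := c ^-2 *: ((1 + 'X) * S ^+ 2)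
            - ((2 * Cap K ^+ (2 * n + 1))%:C)%:P in
   is_chebyshev K (2 * n + 1) T /\
   (forall Q, is_chebyshev K (2 * n + 1) Q -> Q = T))
  /\
  (let K := preim01 ((1 - 'X) * S ^+ 2) in
   K `<=` in_real_segment (-1) 1 ->
   let T := ((2 * Cap K ^+ (2 * n + 1))%:C)%:P
            - c ^-2 *: ((1 - 'X) * S ^+ 2) in
   is_chebyshev K (2 * n + 1) T /\
   (forall Q, is_chebyshev K (2 * n + 1) Q -> Q = T)).
Proof.
move=> n1 sS c.
have S0 : S != 0 by rewrite -size_poly_eq0 sS.
have sS2 : size (S ^+ 2) = (2 * n).+1.
  by rewrite expr2 size_mul// sS addSn /= addnS mul2n addnn.
have X1mon : 1 + 'X \is @monic R[i] by rewrite addrC -[1]opprK -polyCN monicXsubC.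
have X1size : size (1 + 'X : {poly R[i]}) = 2.
  by rewrite addrC -[1]opprK -polyCN size_XsubC.
rewrite addn1; split => K KK T.
- have sP : size ((1 + 'X) * S ^+ 2) = (2 * n).+2.
    by rewrite size_monicM ?expf_neq0// X1size sS2.
  have [p PE pr] := real_poly_of_preim01 sP KK.
  have sp : size p = (2 * n).+2 by rewrite -sP PE size_map_poly.
  have cE : c ^+ 2 = (lead_coef p)%:C.
    by rewrite -lead_coef_map -PE lead_coefM (monicP X1mon) mul1r lead_coef_exp.
  have p1 : p.[-1] = 0.
    apply: (@complexI R); rewrite -horner_map /= -PE hornerM hornerD hornerC hornerX.
    by rewrite rmorphN1 subrr mul0r.
  have a0 : 0 < lead_coef p by apply: (lead_coef_gt0 sp pr) => //=; rewrite mul2n odd_double.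
  suff -> : T = map_poly (real_complex R) ((lead_coef p)^-1 *: (p - 2^-1%:P)).
    by rewrite /K PE; exact: chebyshev_of_real_rooted.
  rewrite /T /K PE (CapE sp pr) gtr0_norm// cE map_polyZ rmorphB /= map_polyC /=.
  rewrite fmorphV scalerBr; congr (_ - _).
  rewrite -mul_polyC -polyCM -fmorphV -rmorphM; congr (_ %:C %:P).
  by field; rewrite gt_eqF.
- have XE : 1 - 'X = (-1) *: ('X - 1%:P) :> {poly R[i]} by rewrite scaleN1r opprB.
  have N1 : -1 != 0 :> R[i] by rewrite oppr_eq0 oner_eq0.
  have sP : size ((1 - 'X) * S ^+ 2) = (2 * n).+2.
    by rewrite XE -scalerAl size_scale// size_monicM ?monicXsubC ?expf_neq0// size_XsubC sS2.
  have [p PE pr] := real_poly_of_preim01 sP KK.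
  have sp : size p = (2 * n).+2 by rewrite -sP PE size_map_poly.
  (* The factor [1 - 'X] has leading coefficient -1. *)
  have cE : c ^+ 2 = (- lead_coef p)%:C.
    rewrite rmorphN /= -lead_coef_map -PE XE -scalerAl lead_coefZ lead_coefM.
    by rewrite lead_coefXsubC mul1r mulN1r opprK lead_coef_exp.
  have p1 : p.[1] = 0.
    apply: (@complexI R); rewrite -horner_map /= -PE hornerM hornerD hornerN hornerC hornerX.
    by rewrite rmorph1 subrr mul0r.
  have a0 : lead_coef p < 0 by exact: (lead_coef_lt0 sp pr).
  suff -> : T = map_poly (real_complex R) ((lead_coef p)^-1 *: (p - 2^-1%:P)).
    by rewrite /K PE; exact: chebyshev_of_real_rooted.
  (* With [a < 0] the capacity term is [- 1 / (2 a)] and [- c ^-2] is [a^-1], so [T] is again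
     [(p - 1/2) / a]. *)
  rewrite /T /K PE (CapE sp pr) ltr0_norm// cE map_polyZ rmorphB /= map_polyC /=.
  rewrite fmorphV scalerBr addrC; congr (_ + _).
    by rewrite rmorphN invrN scaleNr opprK.
  rewrite -mul_polyC -polyCM -fmorphV -rmorphM -polyCN -rmorphN; congr (_ %:C %:P).
  by field; rewrite lt_eqF.
Qed.
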